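(* Let $q=p^r$ with $p>3$ a prime and $r\in\mathbb{Z}^+$. Let $a,b\in\mathbb{F}_q^{\times}$ with $\dfrac{-27b^2}{4a^3}\neq 1$ in $\mathbb{F}_q$. Then $$_{2}G_2\left[\begin{array}{cc} \frac{1}{4}, & \frac{3}{4}\\ \frac{1}{3}, & \frac{2}{3}\end{array}\Big|\,\frac{-27b^2}{4a^3}\right]_q=\phi(-a)\cdot{_{2}}G_2\left[\begin{array}{cc} \frac{1}{4}, & \frac{3}{4}\\ \frac{1}{6}, & \frac{5}{6}\end{array}\Big|\,\frac{-27b^2}{4a^3}\right]_q.$$ In particular, for $a,b\in\mathbb{F}_q^\times$, if $\dfrac{27b^2}{4a^6}\neq 1$ then $$_{2}G_2\left[\begin{array}{cc} \frac{1}{4}, & \frac{3}{4}\\ \frac{1}{3}, & \frac{2}{3}\end{array}\Big|\,\frac{27b^2}{4a^6}\right]_q={_{2}}G_2\left[\begin{array}{cc} \frac{1}{4}, & \frac{3}{4}\\ \frac{1}{6}, & \frac{5}{6}\end{array}\Big|\,\frac{27b^2}{4a^6}\right]_q.$$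
   Context: $\mathbb{F}_q$ is the field with $q=p^r$ elements. $\mathbb{Z}_q$ is the ring of integers of the unramified extension of $\mathbb{Q}_p$ with residue field $\mathbb{F}_q$; it contains all $(q-1)$-th roots of unity, and multiplicative characters of $\mathbb{F}_q^\times$ are regarded as maps $\mathbb{F}_q^\times\to\mathbb{Z}_q^\times$, extended to $\mathbb{F}_q$ by the value $0$ at $0$ (also for the trivial character). $\phi$ is the quadratic character of $\mathbb{F}_q$. $\omega$ is the Teichmüller character: for $a\in\mathbb{F}_q^\times$, $\omega(a)\in\mathbb{Z}_q^\times$ is the $(q-1)$-th root of unity with $\omega(a)\equiv a \pmod p$; $\overline{\omega}=\omega^{-1}$. For $x\in\mathbb{Q}$, $\lfloor x\rfloor$ is the greatest integer $\le x$ and $\langle x\rangle=x-\lfloor x\rfloor$. $\Gamma_p:\mathbb{Z}_p\to\mathbb{Z}_p^\times$ is Morita's $p$-adic gamma function: the unique continuous function with $\Gamma_p(0)=1$ and $\Gamma_p(n)=(-1)^n\prod_{0<j<n,\ p\nmid j}j$ for $n\in\mathbb{Z}^+$. For $n\in\mathbb{Z}^+$, $a_1,\dots,a_n,b_1,\dots,b_n\in\mathbb{Q}\cap\mathbb{Z}_p$ and $t\in\mathbb{F}_q$, define $$_nG_n\left[\begin{array}{cccc} a_1, & a_2, & \ldots, & a_n\\ b_1, & b_2, & \ldots, & b_n\end{array}\Big|\,t\right]_q:=\frac{-1}{q-1}\sum_{j=0}^{q-2}(-1)^{jn}\,\overline{\omega}^j(t)\prod_{i=1}^n\prod_{k=0}^{r-1}(-p)^{-\lfloor\langle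 a_ip^k\rangle-\frac{jp^k}{q-1}\rfloor-\lfloor\langle -b_ip^k\rangle+\frac{jp^k}{q-1}\rfloor}\frac{\Gamma_p(\langle(a_i-\frac{j}{q-1})p^k\rangle)}{\Gamma_p(\langle a_ip^k\rangle)}\frac{\Gamma_p(\langle(-b_i+\frac{j}{q-1})p^k\rangle)}{\Gamma_p(\langle -b_ip^k\rangle)}.$$ *)

(* Defs.v *)
From HB Require Import structures.
From mathcomp Require Import all_boot all_order all_algebra all_field.
From mathcomp Require Import archimedean boolp classical_sets.

Set Implicit Arguments.
Unset Strict Implicit.
Unset Printing Implicit Defensive.

Import Order.TTheory GRing.Theory Num.Theory.
Local Open Scope ring_scope.

(* The ring Z_p as the inverse limit of the rings Z/p^n: the component x_n is
   the representative in [0, p^n) of x modulo p^n.  The bound x_n < p^n is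
   implied by the compatibility condition.  The primality proof is an argument
   of the type so that the ring structures can be canonical. *)
Record padic_int (p : nat) (p_pr : prime p) := PadicInt {
  padic_res : nat -> nat;
  padic_resP : forall n, padic_res n = (padic_res n.+1 %% p ^ n)%N }.

Section PadicIntRing.
Variables (p : nat) (p_pr : prime p).
Local Notation Zp := (padic_int p_pr).
Implicit Types x y z : Zp.

HB.instance Definition _ := gen_eqMixin Zp.
HB.instance Definition _ := gen_choiceMixin Zp.

Lemma padic_eq x y : padic_res x =1 padic_res y -> x = y.
Proof.
case: x y => [u hu] [v hv] /= /funext E; rewrite {}E in hu *.
by congr PadicInt; apply: Prop_irrelevance.
Qed.

Lemma padic_expn_gt0 n : (0 < p ^ n)%N.
Proof. by rewrite expn_gt0 prime_gt0. Qed.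

Lemma padic_res_lt x n : (padic_res x n < p ^ n)%N.
Proof. by rewrite padic_resP ltn_mod padic_expn_gt0. Qed.

Lemma padic_res_mod x n : (padic_res x n %% p ^ n = padic_res x n)%N.
Proof. by rewrite modn_small ?padic_res_lt. Qed.

Lemma padic_res_modD x n m : padic_res x n = (padic_res x (n + m) %% p ^ n)%N.
Proof.
elim: m => [|m IH]; first by rewrite addn0 padic_res_mod.
by rewrite IH addnS (padic_resP x (n + m)) modn_dvdm // dvdn_exp2l // leq_addr.
Qed.

Lemma padic_add_subproof x y n :
  ((padic_res x n + padic_res y n) %% p ^ n =
   (padic_res x n.+1 + padic_res y n.+1) %% p ^ n.+1 %% p ^ n)%N.
Proof.
by rewrite modn_dvdm ?dvdn_exp2l // (padic_resP x) (padic_resP y) modnDm.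
Qed.

Lemma padic_mul_subproof x y n :
  ((padic_res x n * padic_res y n) %% p ^ n =
   (padic_res x n.+1 * padic_res y n.+1) %% p ^ n.+1 %% p ^ n)%N.
Proof.
by rewrite modn_dvdm ?dvdn_exp2l // (padic_resP x) (padic_resP y) modnMm.
Qed.

Lemma padic_nat_subproof k n : (k %% p ^ n = k %% p ^ n.+1 %% p ^ n)%N.
Proof. by rewrite modn_dvdm ?dvdn_exp2l. Qed.

Lemma padic_opp_subproof x n :
  ((p ^ n - padic_res x n) %% p ^ n =
   (p ^ n.+1 - padic_res x n.+1) %% p ^ n.+1 %% p ^ n)%N.
Proof.
rewrite modn_dvdm ?dvdn_exp2l //; apply/eqP.
rewrite -(eqn_modDr (padic_res x n)) subnK 1?ltnW ?padic_res_lt //.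
rewrite [in X in _ == X](padic_resP x n) modnDmr subnK 1?ltnW ?padic_res_lt //.
by rewrite modnn expnS modnMl.
Qed.

Definition padic_add x y : Zp := PadicInt p_pr (padic_add_subproof x y).
Definition padic_mul x y : Zp := PadicInt p_pr (padic_mul_subproof x y).
Definition padic_nat k : Zp := PadicInt p_pr (padic_nat_subproof k).
Definition padic_opp x : Zp := PadicInt p_pr (padic_opp_subproof x).

Fact padic_addA : associative padic_add.
Proof. by move=> x y z; apply: padic_eq => n /=; rewrite modnDml modnDmr addnA. Qed.

Fact padic_addC : commutative padic_add.
Proof. by move=> x y; apply: padic_eq => n /=; rewrite addnC. Qed.

Fact padic_add0 : left_id (padic_nat 0) padic_add.
Proof. by move=> x; apply: padic_eq => n /=; rewrite mod0n padic_res_mod. Qed.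

Fact padic_addN : left_inverse (padic_nat 0) padic_opp padic_add.
Proof.
move=> x; apply: padic_eq => n /=; rewrite modnDml subnK ?modnn ?mod0n //.
by rewrite ltnW ?padic_res_lt.
Qed.

Fact padic_mulA : associative padic_mul.
Proof. by move=> x y z; apply: padic_eq => n /=; rewrite modnMml modnMmr mulnA. Qed.

Fact padic_mulC : commutative padic_mul.
Proof. by move=> x y; apply: padic_eq => n /=; rewrite mulnC. Qed.

Fact padic_mul1 : left_id (padic_nat 1) padic_mul.
Proof.
by move=> x; apply: padic_eq => n /=; rewrite modnMml mul1n padic_res_mod.
Qed.

Fact padic_mulDl : left_distributive padic_mul padic_add.
Proof.
move=> x y z; apply: padic_eq => n /=.
by rewrite modnMml modnDm mulnDl.
Qed.

Fact padic_1neq0 : padic_nat 1 != padic_nat 0.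
Proof.
apply/eqP => /(congr1 (fun x => padic_res x 1)) /=.
by rewrite mod0n expn1 modn_small ?prime_gt1.
Qed.

HB.instance Definition _ :=
  GRing.isZmodule.Build Zp padic_addA padic_addC padic_add0 padic_addN.
HB.instance Definition _ :=
  GRing.Zmodule_isComNzRing.Build Zp padic_mulA padic_mulC padic_mul1
    padic_mulDl padic_1neq0.

Definition padic_unit : pred Zp := fun x => `[< exists y, y * x = 1 >].

Definition padic_inv x : Zp := xget x [set y | y * x = 1].

Fact padic_mulVx : {in padic_unit, left_inverse 1 padic_inv *%R}.
Proof. by move=> x /asboolP xU; apply: (@xgetPex _ x [set y | y * x = 1]). Qed.

Fact padic_unitPl x y : y * x = 1 -> padic_unit x.
Proof. by move=> yx; apply/asboolP; exists y. Qed.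

Fact padic_invr_out : {in [predC padic_unit], padic_inv =1 id}.
Proof.
move=> x; rewrite inE /= => /negP xNU; apply: xgetPN => y yx; apply: xNU.
exact: padic_unitPl yx.
Qed.

HB.instance Definition _ :=
  GRing.ComNzRing_hasMulInverse.Build Zp padic_mulVx padic_unitPl
    padic_invr_out.

Fact padic_mulf_eq0 : GRing.integral_domain_axiom Zp.
Proof.
move=> x y xy0; apply/orP.
have nz z : z != 0 -> exists n, padic_res z n != 0%N.
  move=> z0; apply: contrapT => /forallNP zn; case/eqP: z0.
  by apply: padic_eq => n /=; rewrite mod0n; apply/eqP/negPn/negP/zn.
have [_|/nz[n xn]] := eqVneq x 0; first by left.
have [_|/nz[m ym]] := eqVneq y 0; first by right.
exfalso; move: xn ym.
rewrite (padic_res_modD x n m) (padic_res_modD y m n) (addnC m n).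
move: (congr1 (fun z => padic_res z (n + m)) xy0) => /=; rewrite mod0n.
move: (padic_res x _) (padic_res y _) => u v uv un vm.
have u0 : (0 < u)%N by rewrite lt0n; apply: contraNneq un => ->; rewrite mod0n.
have v0 : (0 < v)%N by rewrite lt0n; apply: contraNneq vm => ->; rewrite mod0n.
move: un vm; rewrite -!/(dvdn _ _) !pfactor_dvdn // -!ltnNge => un vm.
move/eqP: uv; rewrite -/(dvdn _ _) pfactor_dvdn ?muln_gt0 ?u0 // lognM //.
by rewrite leqNgt (leq_trans _ (leq_add un (ltnW vm))).
Qed.

HB.instance Definition _ :=
  GRing.ComUnitRing_isIntegral.Build Zp padic_mulf_eq0.

End PadicIntRing.

Notation padic_rat p_pr := {fraction (padic_int p_pr)}.

Section MoritaGamma.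
Variables (p : nat) (p_pr : prime p).
Local Notation Zp := (padic_int p_pr).

Definition padic_congr (n : nat) (x y : Zp) :=
  exists z : Zp, x - y = p%:R ^+ n * z.

Definition padic_continuous (f : Zp -> Zp) :=
  forall (x : Zp) (n : nat), exists m : nat,
    forall y : Zp, padic_congr m y x -> padic_congr n (f y) (f x).

Definition is_morita_gamma (f : Zp -> Zp) :=
  [/\ forall x, f x \is a GRing.unit,
      padic_continuous f,
      f 0 = 1 &
      forall n : nat, (0 < n)%N ->
        f n%:R = (-1) ^+ n * \prod_(1 <= j < n | ~~ (p %| j)%N) j%:R].

(* The default value of xget is irrelevant: for every prime p there is exactly
   one function satisfying is_morita_gamma. *)
Definition morita_gamma : Zp -> Zp := xget (fun=> 1) is_morita_gamma.

End MoritaGamma.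

Section UnramifiedExtension.
Variables (p : nat) (p_pr : prime p) (L : fieldExtType (padic_rat p_pr)).
Local Notation Zp := (padic_int p_pr).

Definition padic_to_ext : Zp -> L := in_alg L \o (@tofrac Zp).

HB.instance Definition _ := GRing.RMorphism.on padic_to_ext.

Definition ext_integers : pred L := fun x => `[< integralOver padic_to_ext x >].

Fact ext_integers_subring : subring_closed ext_integers.
Proof.
split=> [|x y /asboolP xI /asboolP yI|x y /asboolP xI /asboolP yI].
- by apply/asboolP; apply: integral1.
- by apply/asboolP; apply: integral_sub.
- by apply/asboolP; apply: integral_mul.
Qed.

HB.instance Definition _ :=
  GRing.isSubringClosed.Build L ext_integers ext_integers_subring.

Record ring_of_integers := RingOfIntegers {
  int_val :> L;
  int_valP : int_val \in ext_integers }.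

HB.instance Definition _ := [isSub for int_val].
HB.instance Definition _ := [Choice of ring_of_integers by <:].
HB.instance Definition _ := [SubChoice_isSubComNzRing of ring_of_integers by <:].

Variable F : finFieldType.

(* pi identifies the quotient of the ring of integers by the ideal generated
   by p with the field F; that is, p is a uniformizer (L is unramified over
   Q_p) and F is the residue field of L. *)
Definition unramified_residue_map (pi : {rmorphism ring_of_integers -> F}) :=
  (forall c, exists x, pi x = c) /\
  (forall x, pi x = 0 <-> exists y, x = p%:R * y).

Variable pi : {rmorphism ring_of_integers -> F}.

Definition is_teichmuller (c : F) (z : ring_of_integers) :=
  z ^+ #|F|.-1 = 1 /\ pi z = c.

(* For an unramified residue map, every nonzero c has exactly one
   Teichmueller representative. *)
Definition teichmuller (c : F) : L :=
  if c == 0 then 0 else int_val (xget 0 (is_teichmuller c)).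

Definition teichmuller_bar_exp (j : nat) (c : F) : L :=
  if c == 0 then 0 else (teichmuller c)^-1 ^+ j.

Definition quadratic_char (c : F) : L :=
  if c == 0 then 0 else if [exists d : F, d ^+ 2 == c] then 1 else -1.

End UnramifiedExtension.

Definition frac_part (x : rat) : rat := x - (Num.floor x)%:~R.

Section GFunction.
Variables (p : nat) (p_pr : prime p) (L : fieldExtType (padic_rat p_pr)).
Variables (F : finFieldType) (pi : {rmorphism ring_of_integers L -> F}).
Variable r : nat.

(* Gamma_p at a rational number.  The map ratr sends u / v to the quotient of
   the images of u and v, so it is the inclusion on rationals with denominator
   prime to p; the rationals occurring below are of that kind. *)
Definition gamma_rat (x : rat) : L :=
  padic_to_ext L (morita_gamma (ratr x : padic_int p_pr)).

Definition G_fun (n : nat) (a b : n.-tuple rat) (t : F) : L :=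
  let q := (p ^ r)%N in
  - 1 / (q%:R - 1) *
  \sum_(0 <= j < q.-1)
    (-1) ^+ (j * n)%N * teichmuller_bar_exp pi j t *
    \prod_(i < n) \prod_(0 <= k < r)
      let ai := tnth a i in
      let bi := tnth b i in
      let pk : rat := p%:R ^+ k in
      let s : rat := j%:R / (q%:R - 1) in
      (- p%:R) ^ (- Num.floor (frac_part (ai * pk) - s * pk)
                  - Num.floor (frac_part (- bi * pk) + s * pk)) *
      (gamma_rat (frac_part ((ai - s) * pk)) /
       gamma_rat (frac_part (ai * pk))) *
      (gamma_rat (frac_part ((- bi + s) * pk)) /
       gamma_rat (frac_part (- bi * pk))).

End GFunction.

(* Main.v *)
Require Import Defs.
From HB Require Import structures.
From mathcomp Require Import all_boot all_order all_algebra all_solvable all_field.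
From mathcomp Require Import archimedean boolp classical_sets.
From mathcomp Require Import zify ring lra.

(** The two sides are the same sum, read with a shift of half a period.  With
    s = j / (q - 1), replacing j by j + (q - 1) / 2 adds 1/2 to s; modulo 1 this
    exchanges 1/4 and 3/4 and sends {1/3, 2/3} to {1/6, 5/6}.  Floors and fractional
    parts only see the parameters modulo 1, so the j-th term on the left and the
    shifted term on the right have the same numerators, and the same power of
    - p because <a p^k - s p^k> = <a p^k> - s p^k - floor, which makes the total
    exponent a sum of fractional parts ([G_factor_swap]).  What differs is

    - the Teichmueller factor, by w^((q - 1) / 2)(t) = phi(t)
      ([teichmuller_bar_half]);
    - the normalising constants: for each k, Gamma_p(1/3) Gamma_p(2/3) on the left
      and Gamma_p(1/6) Gamma_p(5/6) on the right.

    Both constants are signs by the reflection formula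
    Gamma_p(x) Gamma_p(1 - x) = (-1)^(a0), a0 being the representative of x modulo p in
    [1, p] ([morita_gamma_reflection]).  The r-th power of the quotient of the two
    signs is phi(3) ([three_exp_half]): -3 is a square exactly when F contains
    cube roots of unity, so everything is decided by p modulo 12 and the parity of r.
    Finally 3 t is - a times a square, whence phi(3) phi(t) = phi(- a).  The second
    identity is the first one at - a^2.

    Two objects of the definition have to be shown to exist.  Gamma_p is built by
    interpolating its values at the natural numbers, which are p^N-periodic
    modulo p^N by Wilson's theorem modulo p^N ([gamma_limP]).  The Teichmueller
    representatives are limits of x^(q^m) in the ring of integers O of L
    ([teichmuller_lift]), which needs O to be p-adically separated and complete
    ([int_separated], [int_complete]). *)

Set Implicit Arguments.
Unset Strict Implicit.
Unset Printing Implicit Defensive.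

Import Order.TTheory GRing.Theory Num.Theory.
Local Open Scope ring_scope.

(** * Wilson's theorem modulo a prime power *)

(** Pairing each unit with its inverse cancels everything but the elements of
    order at most two, here 1 and -1. *)
Lemma Zp_prod_units_sqrt1 (m : nat) :
  (forall x : 'Z_m, x * x = 1 -> x = 1 \/ x = - 1) -> (1 : 'Z_m) != - 1 ->
  \prod_(x : 'Z_m | x \is a GRing.unit) x = - 1.
Proof.
move=> sq1 one_neqN1.
rewrite (bigD1 1) ?unitr1 //= mul1r (bigD1 (- 1)) /= ?unitrN ?unitr1 1?eq_sym //.
pose A (x : 'Z_m) := (x \is a GRing.unit) && (x != 1) && (x != -1).
rewrite [X in _ * X](_ : _ = \prod_(x | A x) x) // [X in _ * X](_ : _ = 1) ?mulr1 //.
have AV x : A x^-1 = A x.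
  by rewrite /A /= unitrV (can2_eq invrK invrK) invr1 (can2_eq invrK invrK) invrN1.
have nsf x : A x -> x != x^-1.
  case/andP => /andP[xU x1] xN1; apply/eqP => xV.
  have /sq1[/eqP|/eqP] : x * x = 1 by rewrite {2}xV divrr.
    by rewrite (negPf x1).
  by rewrite (negPf xN1).
rewrite (bigID (fun x : 'Z_m => (x < x^-1)%N)) /=.
rewrite [X in _ * X](reindex_inj invr_inj) /=.
rewrite [X in _ * X](eq_bigl (fun x => A x && (x < x^-1)%N)); last first.
  move=> x; rewrite AV invrK; case: (boolP (A x)) => //= /nsf xxV.
  by rewrite -leqNgt leq_eqVlt (inj_eq val_inj) (negPf xxV).
rewrite -big_split /= big1 // => x /andP[/andP[/andP[xU _] _] _].
by rewrite divrr.
Qed.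

(** An odd prime cannot divide both x - 1 and x + 1, so p^N divides one of
    them as soon as it divides their product. *)
Lemma prime_pow_sqrt1 (p N : nat) (x : 'Z_(p ^ N)) : prime p -> (2 < p)%N -> (0 < N)%N ->
  x * x = 1 -> x = 1 \/ x = - 1.
Proof.
move=> p_pr p2 N0 xx.
have m1 : (1 < p ^ N)%N by rewrite -(exp1n N) ltn_exp2r ?prime_gt1.
have xm : (x < p ^ N)%N by have := ltn_ord x; rewrite {2}Zp_cast.
have x0 : (0 < x)%N.
  rewrite lt0n; apply/eqP => x0; have : x = 0 by apply: val_inj.
  by move=> E; move: xx; rewrite E mul0r => /eqP; rewrite eq_sym oner_eq0.
have dv : (p ^ N %| (x - 1) * (x + 1))%N.
  rewrite /dvdn -val_Zp_nat // natrM natrD natrB // natr_Zp.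
  have -> : (x - 1) * (x + 1) = x * x - 1 by ring.
  by rewrite xx subrr.
have nat_x : x = (x : nat)%:R by rewrite natr_Zp.
case: (boolP (p %| (x - 1))%N) => [d1|nd1].
  have cop : coprime (p ^ N) (x + 1).
    rewrite coprime_pexpl // prime_coprime //; apply/negP => d2.
    have : (p %| (x + 1) - (x - 1))%N by rewrite dvdn_sub.
    have -> : (x + 1 - (x - 1) = 2)%N by lia.
    by move=> d; have := dvdn_leq (isT : (0 < 2)%N) d; lia.
  move: dv; rewrite Gauss_dvdl // => /dvdnP[k xk]; left.
  rewrite nat_x; have -> : (x : nat) = (x - 1 + 1)%N by lia.
  by rewrite xk natrD natrM pchar_Zp // mulr0 add0r.
have cop : coprime (p ^ N) (x - 1) by rewrite coprime_pexpl // prime_coprime.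
move: dv; rewrite Gauss_dvdr // => /dvdnP[k xk]; right.
by apply/eqP; rewrite -subr_eq0 opprK {1}nat_x -(natrD _ x 1) xk natrM pchar_Zp // mulr0.
Qed.

Lemma prime_pow_Wilson (p N : nat) : prime p -> (2 < p)%N -> (0 < N)%N ->
  ((\prod_(1 <= j < p ^ N | ~~ (p %| j)) j).+1 %% p ^ N = 0)%N.
Proof.
move=> p_pr p2 N0.
have m2 : (2 < p ^ N)%N.
  by apply: leq_trans p2 _; rewrite -{1}(expn1 p) leq_exp2l ?prime_gt1.
have m1 := ltnW m2.
rewrite -val_Zp_nat //; set W := (\prod_(1 <= j < _ | _) _)%N.
suff -> : W.+1%:R = 0 :> 'Z_(p ^ N) by [].
rewrite -[W.+1]addn1 natrD {}/W natr_prod.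
have := @Zp_prod_units_sqrt1 (p ^ N) (fun x => @prime_pow_sqrt1 p N x p_pr p2 N0).
move=> H; have {}H : \prod_(x : 'Z_(p ^ N) | x \is a GRing.unit) x = -1.
  apply: H; apply/eqP => /eqP; rewrite -subr_eq0 opprK -(natrD _ 1 1) => /eqP.
  by move/(congr1 (@nat_of_ord _)); rewrite val_Zp_nat // modn_small.
rewrite [X in X + 1](_ : _ = -1) ?addNr // -[RHS]H.
rewrite (eq_bigl (fun i : 'Z_(p ^ N) => ~~ (p %| i)%N)); last first.
  move=> x; rewrite -[x in LHS]natr_Zp unitZpE // coprime_pexpl //.
  by rewrite prime_coprime.
rewrite (eq_bigr (fun i : 'Z_(p ^ N) => i%:R)); last by move=> x _; rewrite natr_Zp.
rewrite -(@big_mkord _ _ _ (Zp_trunc (p ^ N)).+2 (fun i => ~~ (p %| i)%N)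
  (fun i => i%:R : 'Z_(p ^ N)))
  (_ : index_iota 0 _.+2 = index_iota 0 (p ^ N)); last by rewrite Zp_cast.
rewrite [in RHS]big_mkcond big_ltn ?(ltnW m1) //.
by rewrite dvdn0 /= mul1r -big_mkcond.
Qed.

(** * Residues and units of the p-adic integers *)

Section PadicRes.
Variables (p : nat) (p_pr : prime p).
Local Notation Zp := (padic_int p_pr).
Implicit Types x y z : Zp.

Lemma padic_resD x y n :
  padic_res (x + y) n = ((padic_res x n + padic_res y n) %% p ^ n)%N.
Proof. by []. Qed.

Lemma padic_resM x y n :
  padic_res (x * y) n = ((padic_res x n * padic_res y n) %% p ^ n)%N.
Proof. by []. Qed.

Lemma padic_res_nat k n : padic_res (k%:R : Zp) n = (k %% p ^ n)%N.
Proof.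
elim: k => [|k IH]; first by [].
by rewrite -addn1 natrD padic_resD IH modnDml -[in RHS]modnDmr.
Qed.

Lemma padic_resM_eq x x' y y' n :
  padic_res x n = padic_res x' n -> padic_res y n = padic_res y' n ->
  padic_res (x * y) n = padic_res (x' * y') n.
Proof. by rewrite !padic_resM => -> ->. Qed.

Lemma padic_resD_eq x x' y y' n :
  padic_res x n = padic_res x' n -> padic_res y n = padic_res y' n ->
  padic_res (x + y) n = padic_res (x' + y') n.
Proof. by rewrite !padic_resD => -> ->. Qed.

Lemma padic_resN_eq x x' n :
  padic_res x n = padic_res x' n -> padic_res (- x) n = padic_res (- x') n.
Proof. by move=> E; rewrite -[- x]mulN1r -[- x']mulN1r; apply: padic_resM_eq. Qed.

Lemma padic_eqS x y : (forall n, padic_res x n.+1 = padic_res y n.+1) -> x = y.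
Proof. by move=> E; apply: padic_eq => n; rewrite padic_resP E -padic_resP. Qed.

Fact padic_shift_subproof x n :
  padic_res x n = 0%N -> forall m,
  (padic_res x (n + m) %/ p ^ n =
   (padic_res x (n + m.+1) %/ p ^ n) %% p ^ m)%N.
Proof.
move=> x0 m; rewrite addnS [in LHS]padic_resP.
move: (padic_res x _) => u.
by rewrite modn_divl mulnC expnD.
Qed.

(** Divisibility of x - y by p^n is the same as equality of the n-th residues;
    this turns the continuity statements into computations on natural numbers. *)
Lemma padic_congrP n x y : padic_congr n x y <-> padic_res x n = padic_res y n.
Proof.
have res_pX (z : Zp) : padic_res (p%:R ^+ n * z) n = 0%N.
  by rewrite -natrX padic_resM padic_res_nat modnn mul0n mod0n.
split=> [[z xyz]|xy].
  rewrite -[x](subrK y) xyz padic_resD res_pX add0n padic_res_mod //.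
have xy0 : padic_res (x - y) n = 0%N.
  by rewrite (padic_resD_eq xy (erefl _)) subrr /= mod0n.
rewrite /padic_congr; move: (x - y) xy0 => w w0.
exists (PadicInt p_pr (padic_shift_subproof w0)).
apply: padic_eq => m; rewrite -natrX padic_resM padic_res_nat /= modnMml.
have dv : (p ^ n %| padic_res w (n + m))%N by rewrite /dvdn -padic_res_modD w0.
by rewrite mulnC divnK // [(n + m)%N]addnC -padic_res_modD.
Qed.

(** The inverse modulo p^n is a power of the residue, by Euler's theorem;
    uniqueness of inverses makes these residues compatible. *)
Lemma padic_unit_res x : ~~ (p %| padic_res x 1)%N -> x \is a GRing.unit.
Proof.
move=> npx.
have cop n : coprime (padic_res x n) (p ^ n).
  case: n => [|n]; first by rewrite coprimen1.
  rewrite coprime_sym coprime_pexpl // prime_coprime //.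
  by move: npx; rewrite (padic_res_modD x 1 n) add1n expn1 /dvdn modn_mod.
pose v n := (padic_res x n ^ (totient (p ^ n)).-1 %% p ^ n)%N.
have vE n : (v n * padic_res x n = 1 %[mod p ^ n])%N.
  rewrite modnMml -expnSr prednK ?totient_gt0 ?padic_expn_gt0 //.
  by rewrite Euler_exp_totient.
have vP n : (v n = v n.+1 %% p ^ n)%N.
  have vE' : (v n.+1 * padic_res x n = 1 %[mod p ^ n])%N.
    rewrite [in LHS]padic_resP modnMmr.
    rewrite -[LHS](@modn_dvdm (p ^ n.+1)) ?dvdn_exp2l // vE.
    by rewrite modn_dvdm ?dvdn_exp2l.
  (* both v n and v n.+1 invert the n-th residue of x *)
  transitivity ((v n * (v n.+1 * padic_res x n)) %% p ^ n)%N.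
    by rewrite -modnMmr vE' modnMmr muln1 modn_mod.
  by rewrite mulnCA -modnMmr vE modnMmr muln1.
apply: (@padic_unitPl _ _ x (PadicInt p_pr vP)).
by apply: padic_eq => n; rewrite /= vE.
Qed.

Lemma padic_res_unit x : x \is a GRing.unit -> ~~ (p %| padic_res x 1)%N.
Proof.
move=> xU; apply/negP => px; have := mulVr xU.
move/(congr1 (fun z => padic_res z 1)); rewrite padic_resM.
rewrite -modnMmr expn1 (eqP px) muln0 mod0n /= expn1 modn_small ?prime_gt1 //.
Qed.

Lemma padic_nat_unit n : (n%:R : Zp) \is a GRing.unit = ~~ (p %| n)%N.
Proof.
have -> : (p %| n)%N = (p %| padic_res (n%:R : Zp) 1)%N.
  by rewrite padic_res_nat expn1 /dvdn modn_mod.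
by apply/idP/idP; [apply: padic_res_unit | apply: padic_unit_res].
Qed.
End PadicRes.

Section Gamma.
Variables (p : nat) (p_pr : prime p) (p_gt2 : (2 < p)%N).
Local Notation Zp := (padic_int p_pr).
Implicit Types x y z : Zp.

Lemma odd_p : odd p.
Proof. by have [p2|//] := even_prime p_pr; move: p_gt2; rewrite p2. Qed.

(** The factor by which Gamma_p(j + 1) and - Gamma_p(j) differ, at a natural
    number j. *)
Definition unit_part (j : nat) : Zp := if (p %| j)%N then 1 else j%:R.

Definition gamma_nat (n : nat) : Zp := \prod_(0 <= j < n) - unit_part j.

Lemma gamma_natS n : gamma_nat n.+1 = - unit_part n * gamma_nat n.
Proof. by rewrite /gamma_nat big_nat_recr //= mulrC. Qed.

Lemma gamma_natE n : (0 < n)%N -> gamma_nat n =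
  (-1) ^+ n * (\prod_(1 <= j < n | ~~ (p %| j)) j)%N%:R.
Proof.
case: n => // n _; rewrite /gamma_nat big_ltn // /unit_part dvdn0 exprS -mulrA.
rewrite (eq_big_nat _ _ (F2 := fun j => -1 * unit_part j)); last first.
  by move=> j _; rewrite mulN1r.
rewrite big_split /= prodr_const_nat subSS subn0; congr (_ * (_ * _)).
rewrite natr_prod [RHS]big_mkcond; apply: eq_bigr => j _.
by rewrite /unit_part if_neg.
Qed.

Lemma unit_part_unit j : unit_part j \is a GRing.unit.
Proof.
by rewrite /unit_part; case: ifPn => pj; rewrite ?unitr1 ?padic_nat_unit.
Qed.

Lemma gamma_nat_unit n : gamma_nat n \is a GRing.unit.
Proof.
elim: n => [|n IH]; first by rewrite /gamma_nat big_nil unitr1.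
by rewrite gamma_natS unitrM IH unitrN unit_part_unit.
Qed.

(** Wilson's theorem, the sign (-1)^(p^N) = -1 being absorbed. *)
Lemma gamma_nat_pX N : (0 < N)%N ->
  padic_res (gamma_nat (p ^ N)) N = padic_res (1 : Zp) N.
Proof.
move=> N0; rewrite gamma_natE ?padic_expn_gt0 //.
have -> : (-1) ^+ (p ^ N) = -1 :> Zp.
  rewrite -signr_odd oddX; case: N N0 => // N _ /=.
  by rewrite odd_p expr1.
set W := (\prod_(_ <= _ < _ | _) _)%N.
have W0 : padic_res (W.+1%:R : Zp) N = padic_res (0 : Zp) N.
  by rewrite padic_res_nat prime_pow_Wilson //= mod0n.
have -> : -1 * W%:R = - W.+1%:R + 1 :> Zp by rewrite -[W.+1]addn1 natrD; ring.
by rewrite (padic_resD_eq (padic_resN_eq W0) (erefl _)) oppr0 add0r.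
Qed.

Lemma unit_part_congr N i j : (0 < N)%N -> (i = j %[mod p ^ N])%N ->
  padic_res (unit_part i) N = padic_res (unit_part j) N.
Proof.
move=> N0 ij; rewrite /unit_part.
have -> : (p %| i)%N = (p %| j)%N.
  have pd k : (p %| k)%N = (p %| k %% p ^ N)%N.
    by rewrite /dvdn modn_dvdm // -{1}(expn1 p) dvdn_exp2l.
  by rewrite (pd i) ij -pd.
by case: ifP; rewrite // !padic_res_nat.
Qed.

(** The recursion for [gamma_nat] only involves n modulo p^N, and by Wilson's
    theorem it starts again from 1 at n = p^N. *)
Lemma gamma_natD N n : (0 < N)%N ->
  padic_res (gamma_nat (p ^ N + n)) N = padic_res (gamma_nat n) N.
Proof.
move=> N0; elim: n => [|n IH].
  by rewrite addn0 gamma_nat_pX // /gamma_nat big_nil.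
rewrite addnS !gamma_natS; apply: padic_resM_eq => //; apply: padic_resN_eq.
by apply: unit_part_congr => //; rewrite modnDl.
Qed.

Lemma gamma_nat_mod N n : (0 < N)%N ->
  padic_res (gamma_nat (n %% p ^ N)) N = padic_res (gamma_nat n) N.
Proof.
move=> N0; rewrite [in RHS](divn_eq n (p ^ N)); elim: (n %/ _)%N => // k IH.
by rewrite mulSn -addnA gamma_natD.
Qed.

Lemma gamma_nat_congr N i j : (0 < N)%N -> (i = j %[mod p ^ N])%N ->
  padic_res (gamma_nat i) N = padic_res (gamma_nat j) N.
Proof. by move=> N0 ij; rewrite -gamma_nat_mod // ij gamma_nat_mod. Qed.

Fact gamma_lim_subproof x n :
  (padic_res (gamma_nat (padic_res x n)) n =
   padic_res (gamma_nat (padic_res x n.+1)) n.+1 %% p ^ n)%N.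
Proof.
rewrite -padic_resP; case: n => [|n].
  by rewrite padic_resP [RHS]padic_resP !modn1.
by rewrite (padic_resP x) gamma_nat_mod.
Qed.

(** Interpolation from the natural numbers: the residues are compatible because
    [gamma_nat] is p^n-periodic modulo p^n. *)
Definition gamma_lim x : Zp := PadicInt p_pr (gamma_lim_subproof x).

Lemma gamma_limP : is_morita_gamma gamma_lim.
Proof.
have limE n : gamma_lim n%:R = gamma_nat n.
  by apply: padic_eqS => N /=; rewrite padic_res_nat gamma_nat_mod.
split.
- by move=> x; apply: padic_unit_res; apply: padic_res_unit (gamma_nat_unit _).
- move=> x n; exists n => y /padic_congrP E; apply/padic_congrP.
  by rewrite /= E.
- by rewrite (limE 0%N) /gamma_nat big_nil.
- by move=> n n0; rewrite limE gamma_natE // natr_prod.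
Qed.

Lemma morita_gammaP : is_morita_gamma (@morita_gamma p p_pr).
Proof. exact: (@xgetPex _ _ (@is_morita_gamma p p_pr) (ex_intro _ _ gamma_limP)). Qed.

(** Continuity determines a Morita function from its values at natural
    numbers; hence the residues are those of [gamma_nat] with the sharp modulus N,
    although [is_morita_gamma] only provides some modulus of continuity. *)
Lemma morita_gamma_res x N n : (0 < N)%N ->
  padic_res x N = (n %% p ^ N)%N ->
  padic_res (morita_gamma x) N = padic_res (gamma_nat n) N.
Proof.
move=> N0 xn; have [_ cont g0 gn] := morita_gammaP.
have gE k : morita_gamma k%:R = gamma_nat k.
  case: k => [|k]; first by rewrite g0 /gamma_nat big_nil.
  by rewrite gn // gamma_natE // natr_prod.
have [M contM] := cont x N.
have /contM/padic_congrP : padic_congr M (padic_res x (N + M))%:R x.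
  apply/padic_congrP; rewrite padic_res_nat.
  by rewrite addnC -padic_res_modD.
rewrite gE => <-; apply: gamma_nat_congr => //.
by rewrite -padic_res_modD.
Qed.

(** The reflection formula modulo p^N, with n = p^N - i in the role of
    1 - (i + 1).  Passing from i to i + 1 multiplies the first factor by - (i + 1) and
    divides the second one by - n, which is congruent to i + 1: the sign changes
    exactly when p does not divide i + 1. *)
Lemma gamma_nat_reflection N i n : (0 < N)%N -> (i + n = p ^ N)%N ->
  padic_res (gamma_nat i.+1 * gamma_nat n) N =
  padic_res ((-1) ^+ (i.+1 + i %/ p) : Zp) N.
Proof.
move=> N0; elim: i n => [|i IH] n inp.
  rewrite add0n in inp; rewrite inp div0n addn0 expr1.
  rewrite (padic_resM_eq (erefl _) (gamma_nat_pX N0)) gamma_natS /gamma_nat.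
  by rewrite big_nil /unit_part dvdn0 !mulr1.
have pN : (p %| i.+1 + n)%N by rewrite inp dvdn_exp.
have := IH n.+1; rewrite addnS -addSn => /(_ inp) {}IH.
rewrite divnS ?prime_gt0 //.
case: (boolP (p %| i.+1)%N) => pi.
  have pn : (p %| n)%N by rewrite -(dvdn_addr n pi).
  have -> : gamma_nat i.+2 * gamma_nat n = gamma_nat i.+1 * gamma_nat n.+1.
    by rewrite [gamma_nat i.+2]gamma_natS [gamma_nat n.+1]gamma_natS /unit_part pi pn; ring.
  by rewrite IH addnCA add1n addSn !exprS !mulN1r opprK.
have npn : ~~ (p %| n)%N by apply: contra pi => pn; rewrite -(dvdn_addl _ pn).
have E : padic_res (- i.+1%:R : Zp) N = padic_res (n%:R : Zp) N.
  have -> : - i.+1%:R = n%:R - (p ^ N)%:R :> Zp by rewrite -inp natrD; ring.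
  rewrite -[in RHS](subr0 n%:R); apply: padic_resD_eq => //; apply: padic_resN_eq.
  by rewrite padic_res_nat modnn /= mod0n.
have -> : gamma_nat i.+2 * gamma_nat n = - i.+1%:R * (gamma_nat i.+1 * gamma_nat n).
  by rewrite gamma_natS /unit_part (negPf pi) mulrA.
rewrite (padic_resM_eq E (erefl _)).
have -> : n%:R * (gamma_nat i.+1 * gamma_nat n) = - (gamma_nat i.+1 * gamma_nat n.+1).
  by rewrite [gamma_nat n.+1]gamma_natS /unit_part (negPf npn); ring.
by rewrite (padic_resN_eq IH) add0n addSn [in RHS]exprS mulN1r.
Qed.

(** The sign in [gamma_nat_reflection] depends only on x modulo p: as p is odd,
    adding p to i changes the parities of both i + 1 and i %/ p.  It is therefore the
    same modulo every power of p. *)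
Lemma morita_gamma_reflection x : x \is a GRing.unit ->
  morita_gamma x * morita_gamma (1 - x) = (-1) ^+ padic_res x 1.
Proof.
move=> /padic_res_unit px; apply: padic_eqS => N.
have xN := padic_res_modD x 1 N; rewrite add1n expn1 in xN.
case E : (padic_res x N.+1) => [|i]; first by move: px; rewrite xN E mod0n dvdn0.
have ip : (i.+1 <= p ^ N.+1)%N by rewrite -E ltnW ?padic_res_lt.
pose n := (p ^ N.+1 - i)%N.
have inp : (i + n = p ^ N.+1)%N by rewrite /n subnKC // ltnW.
have g1 : padic_res (morita_gamma x) N.+1 = padic_res (gamma_nat i.+1) N.+1.
  by apply: morita_gamma_res => //; rewrite -E padic_res_mod.
have g2 : padic_res (morita_gamma (1 - x)) N.+1 = padic_res (gamma_nat n) N.+1.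
  apply: morita_gamma_res => //; rewrite -padic_res_nat.
  have xi : padic_res (- x) N.+1 = padic_res (- i.+1%:R : Zp) N.+1.
    by apply: padic_resN_eq; rewrite padic_res_nat -E padic_res_mod.
  rewrite (padic_resD_eq (erefl _) xi).
  have -> : 1 - i.+1%:R = n%:R - (p ^ N.+1)%:R :> Zp.
    by rewrite -inp natrD -[i.+1]addn1 natrD; ring.
  rewrite -[in RHS](subr0 n%:R); apply: padic_resD_eq => //; apply: padic_resN_eq.
  by rewrite padic_res_nat modnn /= mod0n.
rewrite (padic_resM_eq g1 g2) gamma_nat_reflection //; congr padic_res.
rewrite -signr_odd -[RHS]signr_odd; congr (_ ^+ (nat_of_bool _)).
rewrite xN E; move: px; rewrite xN E /dvdn modn_mod modnS.
case: ifP; rewrite ?mod0n // => _ _.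
rewrite oddD /= {1}(divn_eq i p) oddD oddM.
by rewrite odd_p andbT; case: (odd _); case: (odd _).
Qed.
End Gamma.

(** * Integral elements of a finite extension *)

(** The valuation is the first index with a nonzero next residue. *)
Lemma padic_factor (p : nat) (p_pr : prime p) (b : padic_int p_pr) : b != 0 ->
  exists v e, e \is a GRing.unit /\ b = p%:R ^+ v * e.
Proof.
move=> b0.
have exn : exists n, padic_res b n != 0%N.
  apply: contrapT => /forallNP bn; case/eqP: b0; apply: padic_eq => n /=.
  by rewrite mod0n; apply/eqP/negPn/negP/bn.
case: (ex_minnP exn) => -[|n]; first by rewrite padic_resP modn1.
move=> bn min_n.
have /padic_congrP[e be] : padic_res b n = padic_res (0 : padic_int p_pr) n.
  by rewrite [RHS]mod0n; apply/eqP/negPn/negP => /min_n; rewrite ltnn.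
rewrite subr0 in be; exists n, e; split=> //; apply: padic_unit_res.
apply: contra bn => pe.
have /padic_congrP[e' ee'] : padic_res e 1 = padic_res (0 : padic_int p_pr) 1.
  by rewrite -padic_res_mod [in LHS]expn1 (eqP pe) /= mod0n.
move: ee'; rewrite subr0 be => ->; rewrite mulrA -exprD addn1 -natrX padic_resM padic_res_nat modnn.
by rewrite mul0n mod0n.
Qed.

Lemma frac_numden (R : idomainType) (c : {fraction R}) :
  exists n d : R, d != 0 /\ c * tofrac d = tofrac n.
Proof.
elim/quotW: c => x; exists \n_x, \d_x; split; first exact: denom_ratioP.
unlock tofrac; rewrite -[LHS]FracField.pi_mul; apply/eqmodP.
rewrite /= FracField.equivfE /FracField.mulf !numden_Ratio ?mulf_neq0 ?oner_eq0 ?denom_ratioP //.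
by rewrite !mulr1 mulrC.
Qed.

Section Ext.
Variables (p : nat) (p_pr : prime p) (L : fieldExtType (padic_rat p_pr)).
Local Notation Zp := (padic_int p_pr).
Local Notation O := (ring_of_integers L).
Local Notation iota := (padic_to_ext L).

Lemma padic_to_ext_inj : injective iota.
Proof. by move=> x y /fmorph_inj/eqP; rewrite tofrac_eq => /eqP. Qed.

Lemma padic_nat_eq0 n : (n%:R == 0 :> Zp) = (n == 0)%N.
Proof.
apply/eqP/eqP => [|-> //].
move=> /(congr1 (fun x => padic_res x n)); rewrite padic_res_nat /= mod0n.
by rewrite modn_small // ltn_expl // prime_gt1.
Qed.

Lemma ext_nat_eq0 n : (n%:R == 0 :> L) = (n == 0)%N.
Proof.
by rewrite -padic_nat_eq0 -(inj_eq padic_to_ext_inj) rmorph_nat rmorph0.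
Qed.

(** If x = 1/p were a root of a monic polynomial of degree d, multiplying
    the equation by p^d would exhibit p as a unit. *)
Lemma p_inv_not_integral (x : L) : ext_integers x -> p%:R * x != 1.
Proof.
move=> /asboolP[q q_mon /rootP qx]; apply/eqP => px.
set d := (size q).-1.
have sq : size q = d.+1 by rewrite /d prednK // size_poly_gt0 monic_neq0.
(* the equation q(x) = 0 multiplied by p^d *)
pose S : Zp := \sum_(i < d.+1) q`_i * p%:R ^+ (d - i).
have S0 : S = 0.
  apply: padic_to_ext_inj; rewrite rmorph0 -[RHS](mulr0 (p%:R ^+ d)) -qx.
  rewrite horner_coef size_map_poly_id0; last first.
    by rewrite (monicP q_mon) rmorph1 oner_neq0.
  rewrite sq mulr_sumr rmorph_sum; apply: eq_bigr => i _.
  rewrite coef_map rmorphM rmorphXn rmorph_nat mulrCA; congr (_ * _).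
  have -> : p%:R ^+ d = p%:R ^+ (d - i) * p%:R ^+ i :> L.
    by rewrite -exprD subnK // -ltnS.
  by rewrite -mulrA -exprMn px expr1n mulr1.
have : (p%:R : Zp) \is a GRing.unit.
  move: S0; rewrite /S big_ord_recr /= subnn mulr1.
  have -> : q`_d = 1 by rewrite -(monicP q_mon) lead_coefE.
  rewrite (eq_bigr (fun i : 'I_d => p%:R * (q`_i * p%:R ^+ (d - i).-1))); last first.
    by move=> i _; rewrite mulrCA -exprS prednK // subn_gt0.
  rewrite -mulr_sumr => /eqP; rewrite addr_eq0 => /eqP E.
  by apply/unitrPr; exists (- \sum_(i < d) q`_i * p%:R ^+ (d - i).-1); rewrite mulrN E opprK.
by rewrite padic_nat_unit dvdnn.
Qed.

Lemma padic_to_ext_integral a : iota a \in @ext_integers p p_pr L.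
Proof. by apply/asboolP; apply: integral_id. Qed.

(** Only the p-part of a denominator fails to be invertible. *)
Lemma frac_scale (c : padic_rat p_pr) : exists v (a : Zp), p%:R ^+ v * c = tofrac a.
Proof.
have [a [b [b0 cb]]] := frac_numden c.
have [v [e [eU bE]]] := padic_factor b0.
have bf0 : tofrac b != 0 by rewrite tofrac_eq0.
exists v, (a * e^-1); apply: (mulIf bf0); rewrite -mulrA cb.
rewrite -(rmorph_nat (@tofrac Zp)) -rmorphXn -!rmorphM /= bE; congr tofrac.
by rewrite mulrCA -mulrA mulVr // mulr1 mulrC.
Qed.

(** Multiplying x by c multiplies the coefficient of degree i of its
    minimal polynomial of degree d by c^(d - i), so a common denominator p^k of the
    coefficients makes p^k x integral. *)
Lemma ext_scale_integral (x : L) : exists k, ext_integers (p%:R ^+ k * x).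
Proof.
set m := minPoly 1 x.
have coefm i : exists v, exists a : Zp, p%:R ^+ v * m`_i = iota a.
  have : m`_i \in 1%VS by apply/polyOverP: i; apply: minPolyOver.
  case/vlineP => c ->; have [v [a ca]] := frac_scale c; exists v, a.
  rewrite /padic_to_ext /= -ca -scalerA -!natrX scaler_nat.
  by rewrite mulr_natl.
have {coefm}[v coefm] := choice coefm.
pose d := (size m).-1.
have sm : size m = d.+1 by rewrite /d prednK // size_poly_gt0 monic_neq0 ?monic_minPoly.
pose k := (\sum_(i < d) v i)%N; exists k.
pose P := \poly_(i < d.+1) ((p%:R ^+ k) ^+ (d - i) * m`_i).
have md : m`_d = 1 by rewrite -(monicP (monic_minPoly 1 x)) lead_coefE.
have Pd : P`_d = 1 by rewrite coef_poly ltnSn subnn mul1r.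
have sP : size P = d.+1.
  apply/eqP; rewrite eqn_leq size_poly /=; apply/contraT; rewrite -leqNgt.
  by move/leq_sizeP/(_ d (leqnn _)); rewrite Pd => /eqP; rewrite oner_eq0.
apply/asboolP; apply: (@integral_root_monic _ _ _ _ P).
- by rewrite monicE lead_coefE sP Pd.
- apply/rootP; rewrite horner_poly.
  have /rootP := root_minPoly 1 x; rewrite -/m horner_coef sm => E.
  transitivity ((p%:R ^+ k) ^+ d * \sum_(i < d.+1) m`_i * x ^+ i); last first.
    by rewrite E mulr0.
  rewrite mulr_sumr; apply: eq_bigr => i _.
  have -> : (p%:R ^+ k) ^+ d = (p%:R ^+ k) ^+ (d - i) * (p%:R ^+ k) ^+ i :> L.
    by rewrite -exprD subnK // -ltnS.
  by rewrite exprMn mulrACA.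
- apply/integral_poly => i; rewrite coef_poly; case: ifP => [|_]; last exact: integral0.
  rewrite ltnS leq_eqVlt => /predU1P[->|id].
    by rewrite subnn mul1r md; apply: integral1.
  have [a ma] := coefm i.
  have -> : (d - i = (d - i).-1.+1)%N by lia.
  have vk : (v i <= k)%N by rewrite /k (bigD1 (Ordinal id)) //= leq_addr.
  rewrite exprSr -mulrA -{2}(subnK vk) exprD -(mulrA (_ ^+ (k - v i))) ma.
  rewrite mulrA; apply: integral_mul; last exact: integral_id.
  by rewrite -exprM -exprD -natrX; apply: integral_nat.
Qed.

End Ext.

(** * Completeness of the ring of integers and Teichmueller lifts *)

Section DivPow.
Variables (O : comNzRingType) (p : nat).
Implicit Types x y : O.

Definition dvd_pX (m : nat) x := exists z : O, x = p%:R ^+ m * z.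

Lemma dvd_pXD m x y : dvd_pX m x -> dvd_pX m y -> dvd_pX m (x + y).
Proof. by move=> [u ->] [v ->]; exists (u + v); rewrite mulrDr. Qed.

Lemma dvd_pXM m x y : dvd_pX m x -> dvd_pX m (x * y).
Proof. by move=> [u ->]; exists (u * y); rewrite mulrA. Qed.

Lemma dvd_pXN m x : dvd_pX m x -> dvd_pX m (- x).
Proof. by move=> [u ->]; exists (- u); rewrite mulrN. Qed.

Lemma dvd_pX_sum (I : finType) m (f : I -> O) :
  (forall i, dvd_pX m (f i)) -> dvd_pX m (\sum_i f i).
Proof.
move=> fm; apply: (big_ind (dvd_pX m)) => //; last exact: dvd_pXD.
by exists 0; rewrite mulr0.
Qed.
End DivPow.

Section Ext.
Variables (p : nat) (p_pr : prime p) (L : fieldExtType (padic_rat p_pr)).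
Local Notation Zp := (padic_int p_pr).
Local Notation O := (ring_of_integers L).

Lemma int_valM (x y : O) : int_val (x * y) = int_val x * int_val y.
Proof. by []. Qed.

Lemma int_val_nat n : int_val (n%:R : O) = n%:R.
Proof. by elim: n => // n IH; rewrite -[n.+1]addn1 !natrD -IH. Qed.

Lemma int_valX (x : O) n : int_val (x ^+ n) = int_val x ^+ n.
Proof. by elim: n => // n IH; rewrite !exprS -IH. Qed.

Definition int_of_padic (a : Zp) : O := RingOfIntegers (padic_to_ext_integral L a).

Lemma int_of_padicB a b : int_of_padic (a - b) = int_of_padic a - int_of_padic b.
Proof. by apply: val_inj; rewrite /= rmorphB. Qed.

Lemma int_of_padicM a b : int_of_padic (a * b) = int_of_padic a * int_of_padic b.
Proof. by apply: val_inj; rewrite /= rmorphM. Qed.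

Lemma int_of_padic_nat n : int_of_padic n%:R = n%:R.
Proof. by apply: val_inj; rewrite /= rmorph_nat int_val_nat. Qed.

(** If w were nonzero, p^k / w would be integral for some k; as w / p^(k + 1) is
    integral too, so would be their product 1 / p. *)
Lemma int_separated (w : O) : (forall m, dvd_pX p m w) -> w = 0.
Proof.
move=> wm; apply/eqP/negPn/negP => w0.
have w0' : int_val w != 0 by rewrite -[0]/(int_val (0 : O)) (inj_eq val_inj).
have [k uk] := ext_scale_integral (int_val w)^-1.
have [z wz] := wm k.+1.
have : ext_integers (int_val z * (p%:R ^+ k * (int_val w)^-1)).
  by apply: rpredM; first exact: int_valP.
move/p_inv_not_integral/negP; apply; apply/eqP.
have ->: p%:R * (int_val z * (p%:R ^+ k * (int_val w)^-1)) =
  (p%:R ^+ k.+1 * int_val z) / int_val w by rewrite exprS; ring.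
suff -> : p%:R ^+ k.+1 * int_val z = int_val w by rewrite divff.
by rewrite wz int_valM int_valX int_val_nat.
Qed.

Variables (F : finFieldType) (pi : {rmorphism ring_of_integers L -> F}).
Hypothesis pi_unr : unramified_residue_map pi.

(** Expand the limit in base p with digits in a set s of representatives of F:
    the digit d_m is read off in the residue field.  Grouping equal digits gives
    a finite sum over c in F of s(c) times the p-adic integer whose m-th digit is 1 if
    d_m = c and 0 otherwise, so completeness of Z_p suffices. *)
Lemma int_complete (y : nat -> O) : (forall m, dvd_pX p m (y m.+1 - y m)) ->
  exists l, forall m, dvd_pX p m (l - y m).
Proof.
move=> yC; have [surj ker] := pi_unr.
have [s sK] := choice surj.
(* the quotient by p^m where it exists; elsewhere the value is irrelevant *)
pose quo m (x : O) : O := xget 0 [set z | x = p%:R ^+ m * z].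
have quoP m x : dvd_pX p m x -> x = p%:R ^+ m * quo m x.
  by move=> xm; apply: (@xgetPex _ _ [set z | x = p%:R ^+ m * z]).
pose S := fix S m : O := if m is m'.+1 then
   S m' + p%:R ^+ m' * s (pi (quo m' (y m'.+1 - S m'))) else 0.
(* S m is the partial expansion with the m digits d 0, ..., d (m - 1) *)
pose d m := pi (quo m (y m.+1 - S m)).
have SS m : S m.+1 = S m + p%:R ^+ m * s (d m) by [].
have yS m : dvd_pX p m (y m - S m).
  elim: m => [|m IH]; first by exists (y 0%N - S 0%N); rewrite mul1r.
  have /quoP E : dvd_pX p m (y m.+1 - S m).
    by rewrite -(subrK (y m) (y m.+1)) -addrA; apply: dvd_pXD.
  have [z Ez] : exists z, quo m (y m.+1 - S m) - s (d m) = p%:R * z.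
    by apply/ker; rewrite rmorphB sK subrr.
  by exists z; rewrite SS opprD addrA E exprSr -mulrA -Ez mulrBr.
pose a_res c m := ((\sum_(i < m | d i == c) p ^ i) %% p ^ m)%N.
have aP c m : (a_res c m = a_res c m.+1 %% p ^ m)%N.
  rewrite /a_res modn_dvdm ?dvdn_exp2l // !(big_mkcond (fun i => _ == _)).
  rewrite big_ord_recr /=; case: ifP => _; last by rewrite addn0.
  by rewrite -modnDmr modnn addn0.
pose a c : Zp := PadicInt p_pr (aP c).
exists (\sum_c int_of_padic (a c) * s c) => m.
set l := \sum_c _.
suff lS : dvd_pX p m (l - S m).
  have -> : l - y m = (l - S m) + - (y m - S m) by rewrite opprB addrA subrK.
  by apply: dvd_pXD lS _; apply: dvd_pXN.
have -> : S m = \sum_c int_of_padic (\sum_(i < m | d i == c) p ^ i)%N%:R * s c.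
  elim: m => [|m IH].
    by rewrite big1 // => c _; rewrite big_ord0 int_of_padic_nat mul0r.
  rewrite SS IH (bigD1 (d m)) //= [in RHS](bigD1 (d m)) //= addrAC.
  congr (_ + _).
    rewrite [in RHS]big_mkcond big_ord_recr /= eqxx -big_mkcond !int_of_padic_nat.
    by rewrite natrD mulrDl natrX.
  apply: eq_bigr => c dc; congr (int_of_padic _%:R * _).
  by rewrite [in RHS]big_mkcond big_ord_recr /= eq_sym (negPf dc) addn0 -big_mkcond.
rewrite -sumrB; apply: dvd_pX_sum => c.
rewrite -mulrBl -int_of_padicB; apply: dvd_pXM.
have /padic_congrP[z ->] : padic_res (a c) m = padic_res (((\sum_(i < m | d i == c) p ^ i)%N)%:R : Zp) m.
  by rewrite padic_res_nat.
by exists (int_of_padic z); rewrite int_of_padicM -natrX int_of_padic_nat natrX.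
Qed.

(** u^q - v^q = (u - v) (u^(q-1) + ... + v^(q-1)), and modulo p the second factor is
    q v^(q-1) = 0. *)
Lemma dvd_pX_expB m (q : nat) (u v : O) : (0 < m)%N -> (p %| q)%N ->
  dvd_pX p m (u - v) -> dvd_pX p m.+1 (u ^+ q - v ^+ q).
Proof.
move=> m0 pq [z uv]; have [_ ker] := pi_unr.
have piuv : pi u = pi v.
  apply/eqP; rewrite -subr_eq0 -rmorphB uv; apply/eqP/ker.
  by case: m m0 {uv} => // m _; exists (p%:R ^+ m * z); rewrite exprS mulrA.
have pF : p%:R = 0 :> F by rewrite -(rmorph_nat pi); apply/ker; exists 1; rewrite mulr1.
rewrite subrXX uv.
have [z' ->] : exists z', \sum_(i < q) u ^+ (q.-1 - i) * v ^+ i = p%:R * z'.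
  apply/ker; rewrite rmorph_sum /= (eq_bigr (fun=> pi v ^+ q.-1)); last first.
    by move=> i _; rewrite rmorphM !rmorphXn piuv -exprD subnK // -ltnS (ltn_predK (ltn_ord i)).
  rewrite sumr_const card_ord -mulr_natl.
  by case/dvdnP: pq => k ->; rewrite natrM pF mulr0 mul0r.
by exists (z * z'); rewrite exprSr; ring.
Qed.

(** For any lift x of c, the sequence x^(q^m) is Cauchy by [dvd_pX_expB]; its
    limit is fixed by the q-th power. *)
Lemma teichmuller_lift (r : nat) (r_gt0 : (0 < r)%N) (cardF : #|F| = (p ^ r)%N) (c : F) :
  c != 0 -> exists z, is_teichmuller pi c z.
Proof.
move=> c0; have [surj ker] := pi_unr; have [x xc] := surj c.
set q := #|F|.
have pq : (p %| q)%N by rewrite /q cardF dvdn_exp.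
have Fq (e : F) : e ^+ q = e by exact: expf_card.
pose y m := x ^+ (q ^ m).
have yS m : y m.+1 = y m ^+ q by rewrite /y expnSr exprM.
have piy m : pi (y m) = c.
  by elim: m => [|m IH]; [rewrite /y expn0 expr1 | rewrite yS rmorphXn IH Fq].
have yC m : dvd_pX p m.+1 (y m.+1 - y m).
  elim: m => [|m IH]; first by apply/ker; rewrite rmorphB !piy subrr.
  by rewrite (yS m.+1) [X in _ - X]yS; apply: dvd_pX_expB.
have [m|l ly] := @int_complete y.
  by have [z ->] := yC m; exists (p%:R * z); rewrite exprSr mulrA.
have pil : pi l = c.
  rewrite -(piy 1%N); apply/eqP; rewrite -subr_eq0 -rmorphB; apply/eqP/ker.
  by have [z ->] := ly 1%N; exists z.
have lq : l ^+ q = l.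
  apply/eqP; rewrite -subr_eq0; apply/eqP/int_separated => -[|m].
    by exists (l ^+ q - l); rewrite mul1r.
  have [z lyE] : dvd_pX p m.+2 (l ^+ q - y m.+2).
    by rewrite (yS m.+1); apply: dvd_pX_expB.
  have -> : l ^+ q - l = (l ^+ q - y m.+2) + - (l - y m.+2) by rewrite opprB addrA subrK.
  apply: dvd_pXD; first by exists (p%:R * z); rewrite lyE exprSr mulrA.
  apply: dvd_pXN; have [u ->] := ly m.+2.
  by exists (p%:R * u); rewrite [in LHS]exprSr mulrA.
exists l; split=> //.
have l0 : int_val l != 0.
  apply: contraNneq c0; rewrite -[0]/(int_val (0 : O)) => /val_inj l0.
  by rewrite -pil l0 rmorph0.
apply: val_inj; apply: (mulfI l0); rewrite /= -int_valM -exprS prednK ?lq ?mulr1 //.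
by rewrite cardF expn_gt0 prime_gt0.
Qed.
End Ext.

(** * Quadratic characters of -3 and 3 *)

Section Quad.
Variable (F : finFieldType).
Hypothesis oddF : odd #|F|.
Local Notation n := #|F|.-1.

Lemma finField_expn (c : F) : c != 0 -> c ^+ n = 1.
Proof.
move=> c0; apply: (mulfI c0); rewrite -exprS prednK ?expf_card ?mulr1 //.
by apply/card_gt0P; exists 0.
Qed.

Lemma finField_n_gt0 : (0 < n)%N.
Proof. by have := finNzRing_gt1 F; case: #|F| => [|[]]. Qed.

Lemma finField_prim_root : exists g : F, n.-primitive_root g.
Proof.
pose rs := [seq x <- enum F | x != 0].
have sz : (n <= size rs)%N.
  rewrite size_filter -(leq_add2l 1) add1n prednK; last by apply/card_gt0P; exists 0.
  rewrite cardE -(count_predC (pred1 0)) leq_add2r.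
  by rewrite count_uniq_mem ?enum_uniq // leq_b1.
have /hasP[g _ gP] : has n.-primitive_root rs; last by exists g.
have rs_uniq : uniq rs by apply: filter_uniq; apply: enum_uniq.
apply: has_prim_root sz; rewrite ?finField_n_gt0 //.
apply/allP => x; rewrite mem_filter => /andP[x0 _].
by apply/unity_rootP; apply: finField_expn.
Qed.

Lemma card_pred_half : (n = n./2 * 2)%N.
Proof.
rewrite muln2 even_halfK //.
by have := oddF; rewrite -[X in odd X]prednK //; apply/card_gt0P; exists 0.
Qed.

Lemma Euler_pm1 (c : F) : c != 0 -> c ^+ n./2 = 1 \/ c ^+ n./2 = -1.
Proof.
move=> /finField_expn; rewrite {1}card_pred_half exprM => /eqP; rewrite sqrf_eq1.
by case/orP => /eqP; [left|right].
Qed.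

Lemma Euler_criterion (c : F) : c != 0 ->
  [exists d : F, d ^+ 2 == c] = (c ^+ n./2 == 1).
Proof.
move=> c0; apply/existsP/eqP => [[d /eqP dc]|cn].
  rewrite -dc -exprM mulnC -card_pred_half finField_expn //.
  by apply: contraNneq c0 => d0; rewrite -dc d0 expr0n.
have [g gP] := finField_prim_root.
have [i ci] := prim_rootP gP (finField_expn c0).
move: cn => /eqP; rewrite ci -exprM -(prim_order_dvd gP) {1}card_pred_half mulnC dvdn_pmul2r; last first.
  by have := finField_n_gt0; rewrite {1}card_pred_half muln_gt0 => /andP[].
by case/dvdnP => k ik; exists (g ^+ k); rewrite -exprM -ik.
Qed.

(** A square root d of -3 and a primitive cube root of unity w determine each
    other by d = 2 w + 1. *)
Lemma sqr_neg3 : 2 != 0 :> F -> 3 != 0 :> F ->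
  [exists d : F, d ^+ 2 == - 3] = (3 %| n)%N.
Proof.
move=> two0 three0; apply/existsP/idP => [[d /eqP d2]|].
  pose w := (d - 1) / 2.
  have w1 : w ^+ 2 + w + 1 = 0.
    have -> : w ^+ 2 + w + 1 = (d ^+ 2 + 3) / 4.
      by rewrite /w; field; rewrite two0 (natrM _ 2 2) mulf_neq0.
    by rewrite d2 addNr mul0r.
  have w3 : w ^+ 3 = 1.
    apply/eqP; rewrite -subr_eq0; have -> : w ^+ 3 - 1 = (w - 1) * (w ^+ 2 + w + 1) by ring.
    by rewrite w1 mulr0.
  have wn1 : w != 1.
    by apply: contraNneq three0 => E; rewrite -w1 E; apply/eqP; ring.
  have w0 : w != 0 by apply: contra_eq_neq w1 => ->; rewrite expr0n /= !add0r oner_neq0.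
  have := finField_expn w0; rewrite {1}(divn_eq n 3) exprD mulnC exprM w3 expr1n mul1r.
  rewrite /dvdn; have : (n %% 3 < 3)%N by rewrite ltn_mod.
  case: (n %% 3)%N => [|[|[|//]]] // _ => [/eqP|w2]; first by rewrite (negPf wn1).
  by move: w3; rewrite exprS w2 mulr1 => /eqP; rewrite (negPf wn1).
case/dvdnP => k nk; have [g gP] := finField_prim_root.
pose w := g ^+ k.
have w3 : w ^+ 3 = 1 by rewrite /w -exprM -nk (prim_expr_order gP).
have wn1 : w != 1.
  rewrite /w -(prim_order_dvd gP) nk -[X in ~~ (_ %| X)%N]muln1 dvdn_pmul2l //.
  by have := finField_n_gt0; rewrite nk muln_gt0 => /andP[].
have w1 : w ^+ 2 + w + 1 = 0.
  apply: (@mulfI _ (w - 1)); first by rewrite subr_eq0.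
  have -> : (w - 1) * (w ^+ 2 + w + 1) = w ^+ 3 - 1 by ring.
  by rewrite w3 subrr mulr0.
exists (2 * w + 1); apply/eqP.
have -> : (2 * w + 1) ^+ 2 = 4 * (w ^+ 2 + w + 1) - 3 by ring.
by rewrite w1 mulr0 add0r.
Qed.

End Quad.

(** The congruences give 3 n3 = a p + 1 and 6 n6 = b p + 1 with a < 3 and
    b < 6; what remains depends only on p modulo 12. *)
Lemma gamma_sign_parity (p n3 n6 : nat) : prime p -> (3 < p)%N -> (n3 < p)%N -> (n6 < p)%N ->
  (3 * n3 = 1 %[mod p])%N -> (6 * n6 = 1 %[mod p])%N ->
  odd (n3 + n6) = odd (p.-1)./2 (+) ~~ (3 %| p.-1)%N.
Proof.
move=> p_pr p3 n3p n6p; rewrite !(@modn_small 1) ?prime_gt1 //.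
move=> E3 E6.
have [a Ea] : exists a, (3 * n3 = a * p + 1)%N by exists (3 * n3 %/ p)%N; rewrite {1}(divn_eq (3 * n3) p) E3.
have [b Eb] : exists b, (6 * n6 = b * p + 1)%N by exists (6 * n6 %/ p)%N; rewrite {1}(divn_eq (6 * n6) p) E6.
have a3 : (a < 3)%N by nia.
have b6 : (b < 6)%N by nia.
have np2 : (p %% 2 != 0)%N.
  by apply/negP; rewrite -/(dvdn 2 p) dvdn_prime2 //; move=> /eqP; lia.
have np3 : (p %% 3 != 0)%N.
  by apply/negP; rewrite -/(dvdn 3 p) dvdn_prime2 //; move=> /eqP; lia.
clear E3 E6 p_pr.
case: a a3 Ea => [|[|[|//]]] _ Ea; case: b b6 Eb => [|[|[|[|[|[|//]]]]]] _ Eb; lia.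
Qed.

(** As p^2 = 1 modulo 12, p^r modulo 12 is p or 1 according to the parity of r,
    and both (q - 1) / 2 modulo 2 and q - 1 modulo 3 depend only on q modulo 12. *)
Lemma sign_three_pow (p r : nat) : prime p -> (3 < p)%N ->
  odd ((p ^ r).-1)./2 (+) ~~ (3 %| (p ^ r).-1)%N =
  odd r && (odd (p.-1)./2 (+) ~~ (3 %| p.-1)%N).
Proof.
move=> p_pr p3.
have np2 : (p %% 2 != 0)%N.
  by apply/negP; rewrite -/(dvdn 2 p) dvdn_prime2 //; move=> /eqP; lia.
have np3 : (p %% 3 != 0)%N.
  by apply/negP; rewrite -/(dvdn 3 p) dvdn_prime2 //; move=> /eqP; lia.
have p12 : (p ^ r %% 12 = if odd r then p %% 12 else 1)%N.
  elim: r => [|r IH] //=; rewrite expnS -modnMmr IH; case: (odd r) => /=; last by rewrite muln1.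
  rewrite modnMmr -modnMml -modnMmr.
  have : (p %% 12 < 12)%N by rewrite ltn_mod.
  have : ((p %% 12) %% 2 != 0)%N by rewrite modn_dvdm.
  have : ((p %% 12) %% 3 != 0)%N by rewrite modn_dvdm.
  by case: (p %% 12)%N => [|[|[|[|[|[|[|[|[|[|[|[|]]]]]]]]]]]].
have q0 : (0 < p ^ r)%N by rewrite expn_gt0 prime_gt0.
move: (p ^ r)%N q0 p12 => q q0; clear p_pr; case: (odd r) => /= E; lia.
Qed.

Section Three.
Variables (p r : nat) (F : finFieldType).
Hypotheses (p_pr : prime p) (p3 : (3 < p)%N) (cardF : #|F| = (p ^ r)%N) (pF : p%:R = 0 :> F).

Lemma natr_neq0_ndvd k : ~~ (p %| k)%N -> k%:R != 0 :> F.
Proof.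
have pch : p \in [pchar F] by rewrite inE p_pr pF eqxx.
by rewrite -(dvdn_pcharf pch).
Qed.

Lemma card_odd : odd #|F|.
Proof.
rewrite cardF oddX; apply/orP; right.
by have [p2|//] := even_prime p_pr; move: p3; rewrite p2.
Qed.

(** 3 = (-1) (-3): the Euler criterion turns [sqr_neg3] into the value of
    (-3)^((q - 1) / 2), and the parity lemmas compare it with the sign of the Gamma
    constants. *)
Lemma three_exp_half (n3 n6 : nat) : (n3 < p)%N -> (n6 < p)%N ->
  (3 * n3 = 1 %[mod p])%N -> (6 * n6 = 1 %[mod p])%N ->
  3 ^+ (#|F|.-1)./2 = (-1) ^+ (r * (n3 + n6)) :> F.
Proof.
move=> n3p n6p E3 E6.
have two0 : 2 != 0 :> F.
  by apply: natr_neq0_ndvd; rewrite dvdn_prime2 //; apply/eqP; move: p3; case: (p) => [|[|[|[|]]]].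
have three0 : 3 != 0 :> F.
  by apply: natr_neq0_ndvd; rewrite dvdn_prime2 //; apply/eqP; move: p3; case: (p) => [|[|[|[|]]]].
have N30 : - 3 != 0 :> F by rewrite oppr_eq0.
rewrite -[3 in LHS]opprK [in LHS]exprNn.
have -> : (- 3) ^+ (#|F|.-1)./2 = (-1) ^+ (~~ (3 %| #|F|.-1)%N) :> F.
  rewrite -(sqr_neg3 two0 three0) (Euler_criterion card_odd N30).
  have [->|->] := Euler_pm1 card_odd N30; first by rewrite eqxx expr0.
  case: eqP => [E|_]; last by rewrite expr1.
  by case/eqP: two0; rewrite -[2]/(1 + 1) -{1}E addNr.
rewrite -exprD -signr_odd -[RHS]signr_odd; congr (_ ^+ (nat_of_bool _)).
rewrite oddD oddb cardF sign_three_pow // oddM.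
by rewrite (gamma_sign_parity p_pr p3 n3p n6p E3 E6).
Qed.

End Three.

(** * Fractional parts and the factors of the hypergeometric sum *)

Lemma frac_partDz (x : rat) (m : int) : frac_part (x + m%:~R) = frac_part x.
Proof.
by rewrite /frac_part floorDrz ?intr_int // intrKfloor intrD opprD addrACA subrr addr0.
Qed.

Lemma frac_part_eq (x f : rat) (m : nat) : 0 <= f < 1 -> x + m%:R = f -> frac_part x = f.
Proof.
move=> /andP[f0 f1] xf; rewrite -(frac_partDz _ m) -[m%:~R]/(m%:R) xf /frac_part.
by have /eqP -> : Num.floor f == 0; [rewrite floor_eq // f0 | rewrite subr0].
Qed.

Lemma floor_frac (x : rat) : (Num.floor x)%:~R = x - frac_part x.
Proof. by rewrite /frac_part opprB addrC subrK. Qed.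

Lemma frac_partK (x y : rat) : frac_part (frac_part x + y) = frac_part (x + y).
Proof.
by rewrite [frac_part x]/frac_part addrAC -(frac_partDz _ (Num.floor x)) subrK.
Qed.

Lemma frac_mulDz (n : nat) (u : rat) (m : int) :
  frac_part ((u + m%:~R) * n%:R) = frac_part (u * n%:R).
Proof. by rewrite mulrDl -[n%:R]/(n%:~R) -intrM frac_partDz. Qed.

Lemma frac_part_thirds (n : nat) : ~~ (3 %| n)%N ->
  let x := frac_part (- (1 / 3) * n%:R) in let y := frac_part (- (2 / 3) * n%:R) in
  x = 1 / 3 /\ y = 2 / 3 \/ x = 2 / 3 /\ y = 1 / 3.
Proof.
have := divn_eq n 3; rewrite /dvdn; move: (n %/ 3)%N => m.
have : (n %% 3 < 3)%N by rewrite ltn_mod.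
case: (n %% 3)%N => [|[|[|//]]] //= _ -> _; rewrite natrD natrM; [right|left]; split.
- by apply: (@frac_part_eq _ _ (m + 1)) => //; rewrite natrD; lra.
- by apply: (@frac_part_eq _ _ (2 * m + 1)) => //; rewrite natrD natrM; lra.
- by apply: (@frac_part_eq _ _ (m + 1)) => //; rewrite natrD; lra.
- by apply: (@frac_part_eq _ _ (2 * m + 2)) => //; rewrite natrD natrM; lra.
Qed.

Lemma frac_part_sixths (n : nat) : ~~ (2 %| n)%N -> ~~ (3 %| n)%N ->
  let x := frac_part (- (1 / 6) * n%:R) in let y := frac_part (- (5 / 6) * n%:R) in
  x = 1 / 6 /\ y = 5 / 6 \/ x = 5 / 6 /\ y = 1 / 6.
Proof.
have -> : (2 %| n)%N = (2 %| n %% 6)%N by rewrite /dvdn modn_dvdm.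
have -> : (3 %| n)%N = (3 %| n %% 6)%N by rewrite /dvdn modn_dvdm.
have := divn_eq n 6; move: (n %/ 6)%N => m.
have : (n %% 6 < 6)%N by rewrite ltn_mod.
case: (n %% 6)%N => [|[|[|[|[|[|//]]]]]] //= _ -> _ _; rewrite natrD natrM; [right|left]; split.
- by apply: (@frac_part_eq _ _ (m + 1)) => //; rewrite natrD; lra.
- by apply: (@frac_part_eq _ _ (5 * m + 1)) => //; rewrite natrD natrM; lra.
- by apply: (@frac_part_eq _ _ (m + 1)) => //; rewrite natrD; lra.
- by apply: (@frac_part_eq _ _ (5 * m + 5)) => //; rewrite natrD natrM; lra.
Qed.

Lemma factor_identity (K : fieldType) (P1 P2 x1 x2 y1 y2 A1 A2 B1 B2 : K) :
  A1 != 0 -> A2 != 0 -> B1 != 0 -> B2 != 0 ->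
  P1 * (x1 / A1) * (y1 / B1) * (P2 * (x2 / A2) * (y2 / B2)) * (B1 * B2) =
  P1 * P2 * (x1 * x2 * (y1 * y2)) / (A1 * A2).
Proof. by move=> A10 A20 B10 B20; field; rewrite A10 A20 B10 B20. Qed.

Section Factor.
Variables (p : nat) (p_pr : prime p) (p_gt3 : (3 < p)%N).
Variables (L : fieldExtType (padic_rat p_pr)).
Local Notation Zp := (padic_int p_pr).
Local Notation G := (@gamma_rat p p_pr L).

Lemma gamma_rat_reflection (u : nat) (x y : rat) :
  ~~ (p %| u)%N -> ratr x = (u%:R : Zp)^-1 -> ratr y = 1 - (u%:R : Zp)^-1 ->
  exists m, [/\ (m < p)%N, (u * m = 1 %[mod p])%N & G x * G y = (-1) ^+ m].
Proof.
move=> pu rx ry; exists (padic_res ((u%:R : Zp)^-1) 1).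
have uU : (u%:R : Zp) \is a GRing.unit by rewrite padic_nat_unit.
split.
- by have := padic_res_lt ((u%:R : Zp)^-1) 1; rewrite expn1.
- have /(congr1 (fun z => padic_res z 1)) := mulrV uU.
  by rewrite padic_resM padic_res_nat modnMml /= expn1.
- rewrite /gamma_rat rx ry -rmorphM morita_gamma_reflection ?unitrV //.
    by rewrite rmorphXn rmorphN1.
  exact: leq_trans p_gt3.
Qed.

Lemma gamma_thirds : exists m,
  [/\ (m < p)%N, (3 * m = 1 %[mod p])%N & G (1 / 3) * G (2 / 3) = (-1) ^+ m].
Proof.
have p3 : ~~ (p %| 3)%N by rewrite gtnNdvd.
have U3 : (3%:R : Zp) \is a GRing.unit by rewrite padic_nat_unit.
apply: gamma_rat_reflection => //; rewrite /ratr.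
  have -> : numq (1 / 3) = 1 by [].
  by have -> : denq (1 / 3) = 3 by []; rewrite mul1r.
have -> : numq (2 / 3) = 2 by [].
have -> : denq (2 / 3) = 3 by [].
by apply: (mulIr U3); rewrite mulrBl !mulrVK // mulVr // mul1r; ring.
Qed.

Lemma gamma_sixths : exists m,
  [/\ (m < p)%N, (6 * m = 1 %[mod p])%N & G (1 / 6) * G (5 / 6) = (-1) ^+ m].
Proof.
have p6 : ~~ (p %| 6)%N.
  by rewrite -[6%N]/(2 * 3)%N Euclid_dvdM // negb_or !gtnNdvd // ltnW.
have U6 : (6%:R : Zp) \is a GRing.unit by rewrite padic_nat_unit.
apply: gamma_rat_reflection => //; rewrite /ratr.
  have -> : numq (1 / 6) = 1 by [].
  by have -> : denq (1 / 6) = 6 by []; rewrite mul1r.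
have -> : numq (5 / 6) = 5 by [].
have -> : denq (5 / 6) = 6 by [].
by apply: (mulIr U6); rewrite mulrBl !mulrVK // mulVr // mul1r; ring.
Qed.

(** The factor of [G_fun] for the indices i and k, with n = p^k. *)
Definition G_factor (a b s : rat) (n : nat) : L :=
  (- p%:R) ^ (- Num.floor (frac_part (a * n%:R) - s * n%:R)
                  - Num.floor (frac_part (- b * n%:R) + s * n%:R)) *
      (G (frac_part ((a - s) * n%:R)) / G (frac_part (a * n%:R))) *
      (G (frac_part ((- b + s) * n%:R)) / G (frac_part (- b * n%:R))).

(** The linear terms s n of the two floors cancel. *)
Lemma G_exponent (a b s : rat) (n : nat) :
  (- Num.floor (frac_part (a * n%:R) - s * n%:R)
   - Num.floor (frac_part (- b * n%:R) + s * n%:R))%:~R =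
  frac_part ((a - s) * n%:R) + frac_part ((- b + s) * n%:R)
  - frac_part (a * n%:R) - frac_part (- b * n%:R).
Proof.
rewrite intrD !rmorphN /= !floor_frac !frac_partK -!mulrBl -mulrDl; ring.
Qed.

Lemma ext_pN_neq0 : - p%:R != 0 :> L.
Proof. by rewrite oppr_eq0 ext_nat_eq0 -lt0n prime_gt0. Qed.

(** A change of s that exchanges a1 and a2 modulo 1 and turns -b1, -b2 into -c2, -c1
    modulo 1 permutes the fractional parts in the numerators.  The last hypothesis
    then makes the two exponents of - p equal, by [G_exponent], so that only the Gamma
    constants of the b's and c's remain. *)
Lemma G_factor_swap (a1 a2 b1 b2 c1 c2 s s' : rat) (n : nat) (m1 m2 m3 m4 : int) :
  a1 - s = a2 - s' + m1%:~R -> a2 - s = a1 - s' + m2%:~R ->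
  - b1 + s = - c2 + s' + m3%:~R -> - b2 + s = - c1 + s' + m4%:~R ->
  frac_part (- b1 * n%:R) + frac_part (- b2 * n%:R) =
  frac_part (- c1 * n%:R) + frac_part (- c2 * n%:R) ->
  G_factor a1 b1 s n * G_factor a2 b2 s n *
    (G (frac_part (- b1 * n%:R)) * G (frac_part (- b2 * n%:R))) =
  G_factor a1 c1 s' n * G_factor a2 c2 s' n *
    (G (frac_part (- c1 * n%:R)) * G (frac_part (- c2 * n%:R))).
Proof.
move=> E1 E2 E3 E4 Eb.
have X1 : frac_part ((a1 - s) * n%:R) = frac_part ((a2 - s') * n%:R).
  by rewrite E1 frac_mulDz.
have X2 : frac_part ((a2 - s) * n%:R) = frac_part ((a1 - s') * n%:R).
  by rewrite E2 frac_mulDz.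
have Y1 : frac_part ((- b1 + s) * n%:R) = frac_part ((- c2 + s') * n%:R).
  by rewrite E3 frac_mulDz.
have Y2 : frac_part ((- b2 + s) * n%:R) = frac_part ((- c1 + s') * n%:R).
  by rewrite E4 frac_mulDz.
have G0 x : G x != 0.
  have [gU _ _ _] := morita_gammaP p_pr (ltnW p_gt3).
  apply/eqP => /eqP; rewrite /gamma_rat -(rmorph0 (padic_to_ext L)) (inj_eq (@padic_to_ext_inj _ _ L)).
  by move/eqP => E; have := gU (ratr x); rewrite E unitr0.
have := G_exponent a1 b1 s n; have := G_exponent a2 b2 s n.
have := G_exponent a1 c1 s' n; have := G_exponent a2 c2 s' n.
rewrite /G_factor X1 X2 Y1 Y2.
set e1 := - Num.floor _ - _; set e2 := - Num.floor _ - _.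
set e3 := - Num.floor _ - _; set e4 := - Num.floor _ - _ => R1 R2 R3 R4.
have e12 : e3 + e4 = e1 + e2.
  apply: (@intr_inj rat); rewrite [LHS]intrD [RHS]intrD R1 R2 R3 R4.
  by clear -Eb; lra.
(* the constants of the a's agree on both sides, those of b's and c's cancel *)
rewrite !factor_identity ?G0 //.
have -> : (- p%:R) ^ e4 * (- p%:R) ^ e3 = (- p%:R) ^ e2 * (- p%:R) ^ e1 :> L.
  by rewrite -!expfzDr ?ext_pN_neq0 // addrC e12 addrC.
by congr (_ * _ / _); rewrite [X in X * _]mulrC [X in _ * X]mulrC.
Qed.
End Factor.

(** * The shift by half a period *)

Lemma thirds_sixths_sum : 1 / 3 + 2 / 3 = 1 / 6 + 5 / 6 :> rat.
Proof. lra. Qed.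

Lemma mulr_sign_move (K : comNzRingType) (x y : K) a b :
  x * (-1) ^+ a = y * (-1) ^+ b -> x = (-1) ^+ (a + b) * y.
Proof.
move=> E; have sq : (-1) ^+ a * (-1) ^+ a = 1 :> K by rewrite -expr2 sqrr_sign.
by rewrite exprD -mulrA [_ * y]mulrC -E mulrCA sq mulr1.
Qed.

(** This is the shift j -> j + m modulo 2 m: each half of one range is matched with
    the other half of the other. *)
Lemma sum_half_shift (K : pzRingType) (m : nat) (c : K) (f g : nat -> K) :
  (forall j, f j = c * g (j + m)%N) -> (forall j, f (j + m)%N = c * g j) ->
  \sum_(0 <= j < m + m) f j = c * \sum_(0 <= j < m + m) g j.
Proof.
have halves (e : nat -> K) : \sum_(0 <= j < m + m) e j =
    \sum_(0 <= j < m) e j + \sum_(0 <= j < m) e (j + m)%N.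
  rewrite (@big_cat_nat _ _ _ m) ?leq_addr //=; congr (_ + _).
  by rewrite -[in LHS](add0n m) big_addn add0n addnK.
move=> fg gf; rewrite !halves mulrDr addrC !mulr_sumr.
by congr (_ + _); apply: eq_bigr => j _; [apply: gf | apply: fg].
Qed.

Section Main.
Variables (p : nat) (p_pr : prime p) (p_gt3 : (3 < p)%N).
Variables (r : nat) (r_gt0 : (0 < r)%N).
Variables (F : finFieldType) (cardF : #|F| = (p ^ r)%N).
Variable L : fieldExtType (padic_rat p_pr).
Variable pi : {rmorphism ring_of_integers L -> F}.
Hypothesis pi_unr : unramified_residue_map pi.

Local Notation h := ((p ^ r).-1)./2.
Local Notation n := (p ^ r).-1.

Lemma residue_p_eq0 : p%:R = 0 :> F.
Proof.
have [_ ker] := pi_unr.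
by rewrite -(rmorph_nat pi); apply/ker; exists 1; rewrite mulr1.
Qed.

Lemma F_two_neq0 : 2 != 0 :> F.
Proof. by apply: (natr_neq0_ndvd p_pr residue_p_eq0); rewrite gtnNdvd // ltnW. Qed.

Lemma F_three_neq0 : 3 != 0 :> F.
Proof. by apply: (natr_neq0_ndvd p_pr residue_p_eq0); rewrite gtnNdvd. Qed.

Lemma card_pred_double : n = (h + h)%N.
Proof. by have := card_pred_half (card_odd p_pr p_gt3 cardF); rewrite cardF => {1}->; rewrite muln2 addnn. Qed.

(** Transfers a sign from F to L by sharing the exponent k, which makes the
    quadratic character multiplicative without further case analysis. *)
Lemma quadratic_char_sign (c : F) k : c != 0 -> c ^+ h = (-1) ^+ k ->
  quadratic_char L c = (-1) ^+ k.
Proof.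
move=> c0 ck; rewrite /quadratic_char (negPf c0).
rewrite (Euler_criterion (card_odd p_pr p_gt3 cardF) c0) cardF ck.
rewrite -signr_odd -[in RHS]signr_odd; case: (odd k); rewrite ?expr0 ?eqxx //.
rewrite expr1; case: eqP => // E.
by case/eqP: F_two_neq0; rewrite -[2]/(1 + 1) -{1}E addNr.
Qed.

Lemma Euler_sign (c : F) : c != 0 -> exists k, c ^+ h = (-1) ^+ k.
Proof.
move=> c0; have := Euler_pm1 (card_odd p_pr p_gt3 cardF) c0; rewrite cardF.
by case=> ->; [exists 0%N | exists 1%N].
Qed.

(** The half power is a sign in L and reduces to c^((q - 1) / 2), which Euler's
    criterion identifies with the quadratic character. *)
Lemma teichmuller_spec (c : F) : c != 0 ->
  teichmuller pi c != 0 /\ teichmuller pi c ^+ h = quadratic_char L c.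
Proof.
move=> c0; rewrite /teichmuller (negPf c0).
have [z zP] := teichmuller_lift pi_unr r_gt0 cardF c0.
have [] := @xgetPex _ 0 (is_teichmuller pi c) (ex_intro _ z zP).
set w := xget _ _ => w1 piw; rewrite cardF card_pred_double in w1.
have w1' : int_val w ^+ (h + h) = 1 by rewrite -int_valX w1.
split.
  apply/eqP => w0; move: w1'; rewrite w0 expr0n -card_pred_double.
  have := finField_n_gt0 F; rewrite cardF => /gtn_eqF ->.
  by move/eqP; rewrite eq_sym oner_eq0.
have sgn m : int_val w ^+ h = (-1) ^+ m -> int_val w ^+ h = quadratic_char L c.
  move=> wm; rewrite wm; apply/esym/quadratic_char_sign => //.
  rewrite -piw -rmorphXn -(rmorphN1 pi) -rmorphXn; congr (pi _); apply: val_inj.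
  by rewrite /= int_valX wm int_valX.
have : (int_val w ^+ h) ^+ 2 == 1 by rewrite -exprM muln2 -addnn w1'.
by rewrite sqrf_eq1 => /orP[] /eqP E; [apply: (sgn 0%N) | apply: (sgn 1%N)].
Qed.

(** Both directions of the shift give the same factor, since phi(t) is its own
    inverse. *)
Lemma teichmuller_bar_half (j j' : nat) (t : F) : t != 0 ->
  j' = (j + h)%N \/ j = (j' + h)%N ->
  teichmuller_bar_exp pi j t = quadratic_char L t * teichmuller_bar_exp pi j' t.
Proof.
move=> t0; rewrite /teichmuller_bar_exp (negPf t0).
have [z0 zh] := teichmuller_spec t0.
have [k tk] := Euler_sign t0.
have qq : quadratic_char L t * quadratic_char L t = 1.
  by rewrite (quadratic_char_sign t0 tk) -expr2 sqrr_sign.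
have qV : (teichmuller pi t)^-1 ^+ h = quadratic_char L t.
  have q0 : quadratic_char L t != 0 by rewrite -zh expf_neq0.
  by apply: (mulfI q0); rewrite qq -zh -exprMn divff // expr1n.
case=> ->; rewrite exprD qV; last by rewrite mulrC.
by rewrite mulrCA qq mulr1.
Qed.

Lemma G_funE (a1 a2 b1 b2 : rat) (t : F) :
  G_fun pi r [tuple a1; a2] [tuple b1; b2] t =
  - 1 / ((p ^ r)%N%:R - 1) * \sum_(0 <= j < n) teichmuller_bar_exp pi j t *
   \prod_(0 <= k < r) (G_factor L a1 b1 (j%:R / ((p ^ r)%N%:R - 1)) (p ^ k) *
                        G_factor L a2 b2 (j%:R / ((p ^ r)%N%:R - 1)) (p ^ k)).
Proof.
rewrite /G_fun; congr (_ * _); apply: eq_bigr => j _.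
rewrite mulnC exprM sqrrN !expr1n mul1r; congr (_ * _).
rewrite !big_ord_recl big_ord0 mulr1 -big_split; apply: eq_bigr => k _.
by rewrite /G_factor !(tnth_nth 0) /= !natrX.
Qed.

(** Each of the r factors k contributes the quotient (-1)^(n3 + n6) of the Gamma
    constants; the character phi(t) comes from the shift of j. *)
Lemma G_fun_shift (t : F) (n3 n6 : nat) : t != 0 ->
  gamma_rat L (1 / 3) * gamma_rat L (2 / 3) = (-1) ^+ n3 ->
  gamma_rat L (1 / 6) * gamma_rat L (5 / 6) = (-1) ^+ n6 ->
  G_fun pi r [tuple 1 / 4; 3 / 4] [tuple 1 / 3; 2 / 3] t =
  quadratic_char L t * (-1) ^+ (r * (n3 + n6)) *
  G_fun pi r [tuple 1 / 4; 3 / 4] [tuple 1 / 6; 5 / 6] t.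
Proof.
move=> t0 E3 E6; rewrite !G_funE mulrCA; congr (_ * _).
pose q1 : rat := (p ^ r)%N%:R - 1.
pose T b1 b2 (j : nat) : L := teichmuller_bar_exp pi j t *
   \prod_(0 <= k < r) (G_factor L (1 / 4) b1 (j%:R / q1) (p ^ k) *
                        G_factor L (3 / 4) b2 (j%:R / q1) (p ^ k)).
pose f := T (1 / 3) (2 / 3); pose g := T (1 / 6) (5 / 6).
change (\sum_(0 <= j < n) f j =
  quadratic_char L t * (-1) ^+ (r * (n3 + n6)) * \sum_(0 <= j < n) g j).
have hq : 2 * h%:R = q1.
  have : (h + h).+1 = (p ^ r)%N by rewrite -card_pred_double prednK // expn_gt0 prime_gt0.
  by rewrite /q1; set m := h => <-; rewrite -[(m + m).+1]addn1 !natrD; ring.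
have h0 : (0 < h)%N.
  by rewrite lt0n; apply/eqP => E; have := finField_n_gt0 F; rewrite cardF card_pred_double E.
have q10 : q1 != 0 by rewrite -hq mulf_neq0 // pnatr_eq0 -lt0n.
have fg j j' : j' = (j + h)%N \/ j = (j' + h)%N ->
    f j = quadratic_char L t * (-1) ^+ (r * (n3 + n6)) * g j'.
  move=> jj'; rewrite /f /g /T (teichmuller_bar_half t0 jj') -!mulrA; congr (_ * _).
  rewrite mulrCA; congr (_ * _).
  have -> : (-1) ^+ (r * (n3 + n6)) = \prod_(0 <= k < r) (-1) ^+ (n3 + n6) :> L.
    by rewrite prodr_const_nat subn0 -exprM mulnC.
  rewrite -big_split; apply: eq_bigr => k _ /=.
  have n2 : ~~ (2 %| p ^ k)%N.
    by rewrite Euclid_dvdX // negb_and dvdn_prime2 // (ltn_eqF (ltnW p_gt3)).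
  have n3' : ~~ (3 %| p ^ k)%N.
    by rewrite Euclid_dvdX // negb_and dvdn_prime2 // (ltn_eqF p_gt3).
  (* the parameters of the two sides, compared modulo 1 after the shift of s by 1/2 *)
  have [m1 [m2 [m3 [m4 [M1 M2 M3 M4]]]]] : exists m1 m2 m3 m4 : int,
    [/\ 1 / 4 - j%:R / q1 = 3 / 4 - j'%:R / q1 + m1%:~R :> rat,
        3 / 4 - j%:R / q1 = 1 / 4 - j'%:R / q1 + m2%:~R :> rat,
        - (1 / 3) + j%:R / q1 = - (5 / 6) + j'%:R / q1 + m3%:~R :> rat &
        - (2 / 3) + j%:R / q1 = - (1 / 6) + j'%:R / q1 + m4%:~R :> rat].
    have hh : h%:R / q1 = 1 / 2 by rewrite -hq; field; rewrite pnatr_eq0 -lt0n.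
    have shift i : (i + h)%:R / q1 = i%:R / q1 + 1 / 2 by rewrite natrD mulrDl hh.
    case: jj' => ->; rewrite shift.
      by exists 0, 1, 0, (-1); split; lra.
    by exists (-1), 0, 1, 0; split; lra.
  have Cb : forall x y u v : rat, x = u /\ y = v \/ x = v /\ y = u ->
      x + y = u + v /\ gamma_rat L x * gamma_rat L y = gamma_rat L u * gamma_rat L v.
    by move=> x y u v [] [-> ->]; split; [| | rewrite addrC | rewrite mulrC].
  have [S3 G3] := Cb _ _ _ _ (frac_part_thirds n3').
  have [S6 G6] := Cb _ _ _ _ (frac_part_sixths n2 n3').
  have Eb : frac_part (- (1 / 3) * (p ^ k)%N%:R) + frac_part (- (2 / 3) * (p ^ k)%N%:R) =
    frac_part (- (1 / 6) * (p ^ k)%N%:R) + frac_part (- (5 / 6) * (p ^ k)%N%:R).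
    by rewrite S3 S6 thirds_sixths_sum.
  have := G_factor_swap p_gt3 L M1 M2 M3 M4 Eb.
  rewrite G3 G6 E3 E6 => E.
  exact: mulr_sign_move E.
rewrite [index_iota 0 n](congr1 (index_iota 0) card_pred_double).
by apply: sum_half_shift => j; apply: fg; [left | right].
Qed.

(** phi(3) is the sign (-1)^(r (n3 + n6)), and 3 t equals a up to a
    square. *)
Lemma quadratic_char_three (t a b : F) (n3 n6 : nat) :
  (n3 < p)%N -> (n6 < p)%N ->
  (3 * n3 = 1 %[mod p])%N -> (6 * n6 = 1 %[mod p])%N ->
  t != 0 -> a != 0 -> b != 0 -> 3 * t = a * b ^+ 2 ->
  quadratic_char L t * (-1) ^+ (r * (n3 + n6)) = quadratic_char L a.
Proof.
move=> n3p n6p E3 E6 t0 a0 b0 tab.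
have [k tk] := Euler_sign t0.
have three := three_exp_half p_pr p_gt3 cardF residue_p_eq0 n3p n6p E3 E6.
have bh : (b ^+ 2) ^+ h = 1.
  by rewrite -exprM mul2n -addnn -card_pred_double -cardF finField_expn.
rewrite (quadratic_char_sign t0 tk) -exprD; apply/esym/quadratic_char_sign => //.
have := congr1 (fun x => x ^+ h) tab; rewrite [(3 * t) ^+ h]exprMn [(a * b ^+ 2) ^+ h]exprMn bh mulr1 => <-.
by rewrite -cardF three cardF tk -exprD addnC.
Qed.

Lemma G_fun_thirds_sixths (a b : F) : a != 0 -> b != 0 ->
  let t := - (27 * b ^+ 2) / (4 * a ^+ 3) in
  G_fun pi r [tuple 1 / 4; 3 / 4] [tuple 1 / 3; 2 / 3] t =
  quadratic_char L (- a) *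
  G_fun pi r [tuple 1 / 4; 3 / 4] [tuple 1 / 6; 5 / 6] t.
Proof.
move=> a0 b0 t.
have n40 : 4 != 0 :> F by rewrite (natrM _ 2 2) mulf_neq0 // F_two_neq0.
have n90 : 9 != 0 :> F by rewrite (natrM _ 3 3) mulf_neq0 // F_three_neq0.
have n270 : 27 != 0 :> F by rewrite (natrM _ 9 3) mulf_neq0 // F_three_neq0.
have t0 : t != 0.
  by rewrite mulf_neq0 ?invr_eq0 ?oppr_eq0 ?mulf_neq0 ?expf_neq0.
have [n3 [n3p E3 G3]] := gamma_thirds p_gt3 L.
have [n6 [n6p E6 G6]] := gamma_sixths p_gt3 L.
rewrite (G_fun_shift t0 G3 G6); congr (_ * _).
(* 3 t = - 81 b^2 / (4 a^3) = - a (9 b / (2 a^2))^2 *)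
apply: (@quadratic_char_three _ _ (9 * b / (2 * a ^+ 2))) => //.
- by rewrite oppr_eq0.
- by rewrite mulf_neq0 ?invr_eq0 ?mulf_neq0 ?expf_neq0 // F_two_neq0.
- by rewrite /t; field; rewrite a0 F_two_neq0 n40.
Qed.
End Main.

Theorem theorem1p7 (p : nat) (p_pr : prime p) (p_gt3 : (3 < p)%N)
    (r : nat) (r_gt0 : (0 < r)%N)
    (F : finFieldType) (cardF : #|F| = (p ^ r)%N)
    (L : fieldExtType (padic_rat p_pr))
    (pi : {rmorphism ring_of_integers L -> F})
    (pi_unr : unramified_residue_map pi) :
  (forall a b : F, a != 0 -> b != 0 ->
     let t := - (27 * b ^+ 2) / (4 * a ^+ 3) in
     t != 1 ->
     G_fun pi r [tuple 1 / 4; 3 / 4] [tuple 1 / 3; 2 / 3] t =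
     quadratic_char L (- a) *
     G_fun pi r [tuple 1 / 4; 3 / 4] [tuple 1 / 6; 5 / 6] t) /\
  (forall a b : F, a != 0 -> b != 0 ->
     let t := 27 * b ^+ 2 / (4 * a ^+ 6) in
     t != 1 ->
     G_fun pi r [tuple 1 / 4; 3 / 4] [tuple 1 / 3; 2 / 3] t =
     G_fun pi r [tuple 1 / 4; 3 / 4] [tuple 1 / 6; 5 / 6] t).
Proof.
split=> [a b a0 b0 t _|a b a0 b0 t _].
  exact: (G_fun_thirds_sixths p_gt3 r_gt0 cardF pi_unr a0 b0).
have a20 : - a ^+ 2 != 0 by rewrite oppr_eq0 expf_neq0.
have -> : t = - (27 * b ^+ 2) / (4 * (- a ^+ 2) ^+ 3).
  by rewrite /t exprNn -exprM -signr_odd expr1 mulN1r mulrN invrN mulrNN.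
rewrite (G_fun_thirds_sixths p_gt3 r_gt0 cardF pi_unr a20 b0) opprK.
have -> : quadratic_char L (a ^+ 2) = 1; last by rewrite mul1r.
rewrite /quadratic_char expf_eq0 (negPf a0) /=.
by case: existsP => // -[]; exists a.
Qed.
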